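(* Let $p\ge 1$, let $\boldsymbol{\mu}\in\mathbb{R}^{p+1}$ and $\boldsymbol{\Lambda}\in\mathbb{R}^{(p+1)\times(p+1)}$ be given, and let $\mathbb{P}^G_{\mathbf{X},Y}$ be the (jointly) Gaussian probability distribution of $(\mathbf{X},Y)$, $\mathbf{X}=(X_1,\dots,X_p)$, with first moment $\mathbb{E}[(\mathbf{X}\;\;Y)]=\boldsymbol{\mu}$ and second moment $\mathbb{E}[(\mathbf{X}\;\;Y)^T(\mathbf{X}\;\;Y)]=\boldsymbol{\Lambda}$. Then $\mathbb{P}^G_{\mathbf{X},Y}$ is a minimizer of the problem $$\min_{\mathbb{P}_{\mathbf{X},Y}} \rho_m(\mathbf{X},Y)\quad\text{s.t.}\quad \mathbb{E}_{\mathbb{P}}[(\mathbf{X}\;\;Y)]=\boldsymbol{\mu},\ \ \mathbb{E}_{\mathbb{P}}[(\mathbf{X}\;\;Y)^T(\mathbf{X}\;\;Y)]=\boldsymbol{\Lambda},$$ where the minimum is over all joint probability distributions of $(\mathbf{X},Y)$ on $\mathbb{R}^p\times\mathbb{R}$ with these first and second order moments.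
   Context: Here $(\mathbf{X}\;\;Y)$ denotes the row vector in $\mathbb{R}^{1\times(p+1)}$, so $\boldsymbol{\Lambda}$ is the matrix of second moments. For random variables $\mathbf{X}$ (possibly vector-valued) and $Y$ with joint law $\mathbb{P}$, the Hirschfeld–Gebelein–Rényi (HGR) maximal correlation is $\rho_m(\mathbf{X},Y)=\sup_{f,g}\mathbb{E}_{\mathbb{P}}[f(\mathbf{X})g(Y)]$, the supremum taken over all measurable $f,g$ with $\mathbb{E}[f(\mathbf{X})]=\mathbb{E}[g(Y)]=0$ and $\mathbb{E}[f^2(\mathbf{X})]=\mathbb{E}[g^2(Y)]=1$. *)

(* Defs.v *)
From HB Require Import structures.
From mathcomp Require Import all_boot all_order all_algebra.
From mathcomp Require Import all_classical all_reals all_analysis.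
Set Implicit Arguments. Unset Strict Implicit. Unset Printing Implicit Defensive.
Import Order.TTheory GRing.Theory Num.Theory.
Local Open Scope classical_set_scope.
Local Open Scope ring_scope.

Section defs.
Context {R : realType} {d : measure_display} {T : measurableType d}.

(* A random vector Z = (Z_0,...,Z_p) = (X_1,...,X_p, Y) on (T, P):
   the X-part is the p-tuple of the first p components, Y the last one. *)
Definition Xpart (p : nat) (Z : 'I_p.+1 -> T -> R) (t : T) : p.-tuple R :=
  [tuple Z (widen_ord (leqnSn p) i) t | i < p].

Definition Ypart (p : nat) (Z : 'I_p.+1 -> T -> R) : T -> R := Z ord_max.

Definition gaussian_rv (P : probability T R) (W : T -> R) : Prop :=
  exists m s : R, forall A : set R, measurable A ->
    P (W @^-1` A) = if s == 0 then @dirac _ R m R A else normal_prob m s A.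

Definition jointly_gaussian (n : nat) (P : probability T R) (Z : 'I_n -> T -> R) : Prop :=
  forall a : 'I_n -> R, gaussian_rv P (fun t => \sum_(i < n) a i * Z i t).

Definition has_moments (n : nat) (P : probability T R) (Z : 'I_n -> T -> R)
    (mu : 'rV[R]_n) (Lam : 'M[R]_n) : Prop :=
  (forall i, (\int[P]_t (Z i t)%:E = (mu ord0 i)%:E)%E) /\
  (forall i j, (\int[P]_t (Z i t * Z j t)%:E = (Lam i j)%:E)%E).

Definition hgr_maxcorr (p : nat) (P : probability T R) (X : T -> p.-tuple R) (Y : T -> R)
  : \bar R :=
  ereal_sup [set r : \bar R | exists (f : p.-tuple R -> R) (g : R -> R),
    [/\ measurable_fun setT f, measurable_fun setT g,
        (\int[P]_t (f (X t))%:E = 0)%E /\ (\int[P]_t (g (Y t))%:E = 0)%E,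
        (\int[P]_t (f (X t) ^+ 2)%:E = 1)%E /\ (\int[P]_t (g (Y t) ^+ 2)%:E = 1)%E &
        r = (\int[P]_t (f (X t) * g (Y t))%:E)%E]].

End defs.

(* Main.v *)
(* Every linear combination of the X_i yields an admissible pair of affine test
   functions, and its value depends only on mu and Lam. Hence the maximal
   correlation of any competitor dominates all linear correlations, and it
   suffices to show that the Gaussian one does not exceed a bound rho for them
   (Gebelein-Lancaster; if X or Y is degenerate the Gaussian supremum is over
   the empty set).

   Trigonometric polynomials in linear forms are dense in L2 of the law of X and
   of Y: they form an algebra of bounded functions, polynomials in them
   approximate indicators of half-lines, and the sets whose indicator can be
   approximated form a sigma-algebra. For centered jointly Gaussian L, L' with
   c = E[L L'], the characteristic function E[exp (iL)] = exp (- E[L^2] / 2),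
   obtained from Stein's identity, gives, up to the factor
   exp (- (E[L^2] + E[L'^2]) / 2),
     Cov (cos L, cos L') = cosh c - 1,   Cov (sin L, sin L') = sinh c,
   and the mixed covariances vanish. Expanding in powers of c, the inequality
   2 Cov (F, G) <= rho (Var F + Var G) holds term by term: for every power n >= 1
   it follows from the Schur product theorem and rho^n <= rho. *)
Require Import Defs.
From HB Require Import structures.
From mathcomp Require Import all_boot all_order all_algebra.
From mathcomp Require Import all_classical all_reals all_analysis.
From mathcomp Require Import measurable_realfun ring lra.
Import Order.TTheory GRing.Theory Num.Theory.
Import numFieldNormedType.Exports.
Local Open Scope classical_set_scope.
Local Open Scope ring_scope.
Set Implicit Arguments. Unset Strict Implicit. Unset Printing Implicit Defensive.

(** * Square integrable functions on a probability space *)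

Section square_integrable.
Context {R : realType} {d : measure_display} {T : measurableType d}.
Variable P : probability T R.
Implicit Types F G : T -> R.

Definition mean F : R := \int[P]_t F t.
Definition intble F := P.-integrable setT (EFin \o F).
Definition sqint F := measurable_fun setT F /\ intble (fun t => F t ^+ 2).

Lemma intble_measurable F : intble F -> measurable_fun setT F.
Proof. by move=> /integrableP[/measurable_EFinP]. Qed.

Lemma mean_intE F : intble F -> (\int[P]_t (F t)%:E)%E = (mean F)%:E.
Proof. by move=> iF; rewrite /mean /Rintegral fineK// integrable_fin_num. Qed.

Lemma eq_mean F G : F =1 G -> mean F = mean G.
Proof. by move=> /funext ->. Qed.

Lemma intbleD F G : intble F -> intble G -> intble (fun t => F t + G t).
Proof. by move=> iF iG; have := integrableD measurableT iF iG. Qed.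

Lemma intbleZ k F : intble F -> intble (fun t => k * F t).
Proof. by move=> iF; have := integrableZl measurableT k iF. Qed.

Lemma intbleB F G : intble F -> intble G -> intble (fun t => F t - G t).
Proof. by move=> iF iG; have := integrableB measurableT iF iG. Qed.

Lemma intble_le F G : measurable_fun setT F -> intble G ->
  (forall t, `|F t| <= G t) -> intble F.
Proof.
move=> mF iG FG; apply: le_integrable iG => //; first exact/measurable_EFinP.
by move=> t _ /=; rewrite lee_fin (le_trans (FG t))// ler_norm.
Qed.

Lemma intble_cst k : intble (fun=> k).
Proof. exact: finite_measure_integrable_cst. Qed.

Lemma intble_bounded F M : measurable_fun setT F -> (forall t, `|F t| <= M) ->
  intble F.
Proof. by move=> mF FM; apply: intble_le mF (intble_cst M) _. Qed.

Lemma meanD F G : intble F -> intble G ->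
  mean (fun t => F t + G t) = mean F + mean G.
Proof. by move=> iF iG; rewrite /mean RintegralD. Qed.

Lemma meanB F G : intble F -> intble G ->
  mean (fun t => F t - G t) = mean F - mean G.
Proof. by move=> iF iG; rewrite /mean RintegralB. Qed.

Lemma meanZ k F : intble F -> mean (fun t => k * F t) = k * mean F.
Proof. by move=> iF; rewrite /mean RintegralZl. Qed.

Lemma mean_cst k : mean (fun=> k) = k.
Proof.
rewrite /mean Rintegral_cst//.
have -> : fine (P setT) = 1 by rewrite probability_setT.
by rewrite mulr1.
Qed.

Lemma mean_ge0 F : (forall t, 0 <= F t) -> 0 <= mean F.
Proof. by move=> F0; exact: Rintegral_ge0. Qed.

Lemma le_mean F G : intble F -> intble G -> (forall t, F t <= G t) ->
  mean F <= mean G.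
Proof. by move=> iF iG FG; apply: le_Rintegral. Qed.

Lemma intble_mean_sum (I : Type) (s : seq I) (F : I -> T -> R) :
  (forall i, intble (F i)) ->
  intble (fun t => \sum_(i <- s) F i t) /\
  mean (fun t => \sum_(i <- s) F i t) = \sum_(i <- s) mean (F i).
Proof.
move=> iF; elim: s => [|i s [IH1 IH2]].
  under eq_fun do rewrite big_nil.
  by rewrite big_nil mean_cst; split => //; exact: intble_cst.
under eq_fun do rewrite big_cons.
by rewrite big_cons meanD// IH2; split => //; exact: intbleD.
Qed.

Lemma sqint_mul F G : sqint F -> sqint G -> intble (fun t => F t * G t).
Proof.
move=> [mF iF] [mG iG]; apply: intble_le (intbleD iF iG) _.
  exact: measurable_funM.
by move=> t; rewrite ler_norml; apply/andP; split; nra.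
Qed.

Lemma sqintD F G : sqint F -> sqint G -> sqint (fun t => F t + G t).
Proof.
move=> sF sG; split; first by apply: measurable_funD; [case: sF|case: sG].
have /(intbleD (intbleD sF.2 sG.2)) := intbleZ 2 (sqint_mul sF sG).
by congr intble; apply/funext => t /=; ring.
Qed.

Lemma sqintZ k F : sqint F -> sqint (fun t => k * F t).
Proof.
move=> [mF iF]; split; first exact: measurable_funM.
by have := intbleZ (k ^+ 2) iF; congr intble; apply/funext => t; ring.
Qed.

Lemma sqintB F G : sqint F -> sqint G -> sqint (fun t => F t - G t).
Proof.
move=> sF /(sqintZ (-1)) /(sqintD sF).
by congr sqint; apply/funext => t; ring.
Qed.

Lemma sqint_bounded F M : measurable_fun setT F -> (forall t, `|F t| <= M) ->
  sqint F.
Proof.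
move=> mF FM; split => //; apply: (@intble_bounded _ (M ^+ 2)).
  exact: measurable_funX.
by move=> t; rewrite normrX lerXn2r// nnegrE// (le_trans _ (FM t)).
Qed.

Lemma sqint_cst k : sqint (fun=> k).
Proof. exact: (@sqint_bounded _ `|k|). Qed.

Lemma sqint_sum (I : Type) (s : seq I) (F : I -> T -> R) :
  (forall i, sqint (F i)) -> sqint (fun t => \sum_(i <- s) F i t).
Proof.
move=> sF; elim: s => [|i s IH].
  by under eq_fun do rewrite big_nil; exact: sqint_cst.
by under eq_fun do rewrite big_cons; exact: sqintD.
Qed.

Lemma sqint_intble F : sqint F -> intble F.
Proof.
by move=> sF; have := sqint_mul sF (sqint_cst 1); under eq_fun do rewrite mulr1.
Qed.

Lemma sqint_le F G : measurable_fun setT F -> sqint G ->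
  (forall t, `|F t| <= `|G t|) -> sqint F.
Proof.
move=> mF [mG iG] FG; split => //; apply: intble_le iG _.
  exact: measurable_funX.
by move=> t; rewrite normrX -(real_normK (num_real (G t))) lerXn2r// nnegrE.
Qed.

(** The quadratic form E[(xF + yG)^2] in (x, y) is nonnegative; the bound comes from evaluating it
    at suitable points. *)
Lemma mean_CauchySchwarz F G : sqint F -> sqint G ->
  mean (fun t => F t * G t) ^+ 2 <=
  mean (fun t => F t ^+ 2) * mean (fun t => G t ^+ 2).
Proof.
move=> sF sG.
set A := mean (fun t => F t ^+ 2); set C := mean (fun t => G t ^+ 2).
set B := mean _.
have C0 : 0 <= C by apply: mean_ge0 => t; exact: sqr_ge0.
have A0 : 0 <= A by apply: mean_ge0 => t; exact: sqr_ge0.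
have quad x y : 0 <= x ^+ 2 * A + (2 * x * y) * B + y ^+ 2 * C.
  have : 0 <= mean (fun t => (x * F t + y * G t) ^+ 2).
    by apply: mean_ge0 => t; exact: sqr_ge0.
  rewrite [mean _](@eq_mean _ (fun t => x ^+ 2 * F t ^+ 2 +
      (2 * x * y) * (F t * G t) + y ^+ 2 * G t ^+ 2)); last first.
    by move=> t; ring.
  rewrite !meanD ?meanZ//.
  1-7: by do ?[exact: sF.2|exact: sG.2|exact: sqint_mul|apply: intbleZ|apply: intbleD].
have [C00|Cp] := eqVneq C 0; last first.
  have Cgt : 0 < C by rewrite lt_neqAle eq_sym Cp.
  (* At (C, -B) the form equals C (AC - B^2), and C > 0 can be cancelled. *)
  have := quad C (- B).
  rewrite (_ : _ + _ = C * (A * C - B ^+ 2)); last by ring.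
  by rewrite pmulr_rge0// subr_ge0.
(* When C = 0, the form at (B, -(A + 1)) equals -B^2 (A + 2), which forces B = 0. *)
have := quad B (- (A + 1)); rewrite C00 mulr0 addr0 mulr0.
nra.
Qed.

End square_integrable.

(** * Closure of an algebra of bounded functions in L2 *)

Section step_polynomial.
Context {R : realType}.
Implicit Types (x q r : R) (n m : nat).

Lemma bernoulli_lower x m : 0 <= x <= 1 -> 1 - m%:R * x <= (1 - x) ^+ m.
Proof.
move=> /andP[x0 x1]; elim: m => [|m IH]; first by rewrite mul0r subr0.
rewrite exprS -natr1.
have m0 : 0 <= m%:R :> R by [].
have : (1 - x) * (1 - m%:R * x) <= (1 - x) * (1 - x) ^+ m.
  by apply: ler_wpM2l => //; rewrite subr_ge0.
by apply: le_trans; nra.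
Qed.

(** Induction on m, through (1 - x)(1 + (m + 1) x) <= 1 + m x. *)
Lemma bernoulli_upper x m : 0 <= x <= 1 -> (1 - x) ^+ m * (1 + m%:R * x) <= 1.
Proof.
move=> /andP[x0 x1]; elim: m => [|m]; first by rewrite mul0r addr0 mul1r.
apply: le_trans; rewrite exprSr -mulrA -natr1; apply: ler_wpM2l.
  by apply: exprn_ge0; rewrite subr_ge0.
have m0 : 0 <= m%:R :> R by [].
nra.
Qed.

(** With s = sqrt r, r^n = s^n s^n, and n s^n is at most the sum of s^i over i < n, hence at most 1
    / (1 - s). *)
Lemma cvg_natr_exprn r : 0 <= r < 1 -> (n%:R * r ^+ n) @[n --> \oo] --> (0 : R).
Proof.
move=> /andP[r0 r1]; pose s : R := Num.sqrt r.
have s0 : 0 <= s by exact: sqrtr_ge0.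
have s1 : s < 1 by rewrite -sqrtr1 ltr_sqrt.
have bd n : n%:R * s ^+ n <= (1 - s)^-1.
  rewrite -[leRHS]mul1r ler_pdivlMr ?subr_gt0//.
  apply: (@le_trans _ _ ((\sum_(i < n) s ^+ i) * (1 - s))).
    apply: ler_wpM2r; first by rewrite subr_ge0 ltW.
    rewrite mulr_natl -[X in _ *+ X]card_ord -sumr_const.
    by apply: ler_sum => i _; apply: (ler_wiXn2l s0 (ltW s1)); rewrite ltnW.
  rewrite mulrC -opprB mulNr -subrX1 opprB lerBlDr lerDl exprn_ge0//.
apply: (@squeeze_cvgr _ _ _ _ (cst 0) (fun n => (1 - s)^-1 * s ^+ n)).
- near=> n; rewrite mulr_ge0 ?exprn_ge0//=.
  rewrite -{1}(sqr_sqrtr r0) -/s -exprM mulnC exprM expr2 mulrA.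
  by apply: ler_wpM2r => //; exact: exprn_ge0.
- exact: cvg_cst.
- by apply: cvg_geometric; rewrite ger0_norm.
Unshelve. all: end_near. Qed.

(* The factor n in the exponent forces the limit 0 at the threshold q = 1/2. *)
Definition step_poly n q := (1 - q ^+ n) ^+ (n * 2 ^ n).

Lemma step_poly_itv n q : 0 <= q <= 1 -> 0 <= step_poly n q <= 1.
Proof.
move=> /andP[q0 q1]; have qn1 : q ^+ n <= 1 by exact: exprn_ile1.
rewrite /step_poly exprn_ge0 ?subr_ge0//= exprn_ile1// ?subr_ge0//.
by rewrite lerBlDr lerDl exprn_ge0.
Qed.

(** For m = n 2^n one has m q^n = n (2q)^n. If q < 1/2 this tends to 0 and the lower Bernoulli bound
    gives the limit 1; if q >= 1/2 it is at least n, and the upper bound leaves at most 1 / (n +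
    1). *)
Lemma cvg_step_poly q : 0 <= q <= 1 ->
  step_poly n q @[n --> \oo] --> ((q < 2^-1)%R%:R : R).
Proof.
move=> /andP[q0 q1].
have qn n : 0 <= q ^+ n <= 1 by rewrite exprn_ge0//= exprn_ile1.
have eqn n : (n * 2 ^ n)%:R * q ^+ n = n%:R * (2 * q) ^+ n.
  by rewrite natrM natrX exprMn mulrA.
have [qlt|qge] := ltP q 2^-1.
- apply: (@squeeze_cvgr _ _ _ _ (fun n => 1 - n%:R * (2 * q) ^+ n) (cst 1)).
  + near=> n; rewrite -eqn bernoulli_lower//=.
    by have /andP[] := @step_poly_itv n q (introT andP (conj q0 q1)).
  + rewrite -[X in _ --> X]subr0; apply: cvgB; first exact: cvg_cst.
    by apply: cvg_natr_exprn; lra.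
  + exact: cvg_cst.
- apply: (@squeeze_cvgr _ _ _ _ (cst 0) (fun n => n.+1%:R^-1)).
  + near=> n.
    have /andP[-> _ /=] := @step_poly_itv n q (introT andP (conj q0 q1)).
    rewrite -[leRHS]mul1r ler_pdivlMr//.
    apply: le_trans (bernoulli_upper (n * 2 ^ n) (qn n)).
    apply: ler_wpM2l; first by case/andP: (step_poly_itv n (introT andP (conj q0 q1))).
    rewrite eqn -natr1 addrC lerD2l ler_peMr// exprn_ege1//; lra.
  + exact: cvg_cst.
  + exact: cvg_harmonic.
Unshelve. all: end_near. Qed.

End step_polynomial.

Lemma norm_cvgn_le {R : realType} (u : nat -> R) (l M : R) :
  u n @[n --> \oo] --> l -> (forall n, `|u n| <= M) -> `|l| <= M.
Proof.
move=> ul uM; have c : `|u n| @[n --> \oo] --> `|l| by exact: cvg_norm.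
rewrite -(cvg_lim (@Rhausdorff R) c); apply: limr_le.
  by apply/cvg_ex; exists `|l|.
by near=> n; exact: uM.
Unshelve. all: end_near. Qed.

(** * The L2 closure of an algebra [S] of bounded functions *)

Section L2_closure.
Import HBSimple HBNNSimple.
Context {R : realType} {d : measure_display} {T : measurableType d}.
Variable P : probability T R.
Implicit Types F G : T -> R.

Lemma dominated_mean (F_ : nat -> T -> R) F G :
  (forall n, measurable_fun setT (F_ n)) -> intble P G ->
  (forall n t, `|F_ n t| <= G t) -> (forall t, F_ n t @[n --> \oo] --> F t) ->
  mean P (F_ n) @[n --> \oo] --> mean P F.
Proof.
move=> mF iG FG cF.
have mlim : measurable_fun setT F.
  by apply: (@measurable_fun_cvg _ _ _ _ F_) => // t _; exact: cF.
have FG' t : `|F t| <= G t by exact: norm_cvgn_le (cF t) (FG ^~ t).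
apply: fine_cvg; rewrite -mean_intE; last exact: intble_le iG FG'.
apply: (@dominated_cvg _ _ _ P setT _ (fun n t => (F_ n t)%:E) _ (EFin \o G)) => //.
- by move=> n; exact/measurable_EFinP.
- by move=> t _; apply/fine_cvgP; split; [exact: nearW|exact: cF].
- by move=> n t _ /=; rewrite lee_fin.
Unshelve. all: end_near. Qed.

Variable S : set (T -> R).
Hypothesis S_bounded : forall G, S G ->
  measurable_fun setT G /\ exists M : R, forall t, `|G t| <= M.
Hypothesis S_one : S (fun=> 1).
Hypothesis S_add : forall F G, S F -> S G -> S (fun t => F t + G t).
Hypothesis S_scale : forall k F, S F -> S (fun t => k * F t).
Hypothesis S_mul : forall F G, S F -> S G -> S (fun t => F t * G t).

Definition L2cl F := sqint P F /\
  forall e : R, 0 < e -> exists2 G, S G & mean P (fun t => (F t - G t) ^+ 2) < e.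

Lemma S_sqint G : S G -> sqint P G.
Proof. by move=> /S_bounded[mG [M GM]]; exact: sqint_bounded mG GM. Qed.

Lemma sub_L2cl G : S G -> L2cl G.
Proof.
move=> SG; split; first exact: S_sqint.
move=> e e0; exists G => //.
by under eq_mean do rewrite subrr expr0n; rewrite mean_cst.
Qed.

Lemma L2cl_approx F : sqint P F ->
  (forall e : R, 0 < e -> exists2 G, L2cl G & mean P (fun t => (F t - G t) ^+ 2) < e) ->
  L2cl F.
Proof.
move=> sF H; split => // e e0.
(* By (a + b)^2 <= 2 a^2 + 2 b^2, two mean square errors below e / 4 combine to one below e. *)
have e4 : 0 < e / 4 by rewrite divr_gt0.
have [G [sG +] FG] := H _ e4; move=> /(_ _ e4)[K SK GK]; exists K => //.
have sK := S_sqint SK.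
apply: (@le_lt_trans _ _ (2 * mean P (fun t => (F t - G t) ^+ 2) +
                          2 * mean P (fun t => (G t - K t) ^+ 2))).
  have i1 := (sqintB sF sG).2; have i2 := (sqintB sG sK).2.
  rewrite -!meanZ// -meanD; [|exact: intbleZ..].
  apply: le_mean.
  - exact: (sqintB sF sK).2.
  - by apply: intbleD; exact: intbleZ.
  - move=> t; have : 0 <= (F t - G t - (G t - K t)) ^+ 2 by exact: sqr_ge0.
    by nra.
by lra.
Qed.

Lemma L2clD F G : L2cl F -> L2cl G -> L2cl (fun t => F t + G t).
Proof.
move=> [sF aF] [sG aG]; split; first exact: sqintD.
move=> e e0; have e4 : 0 < e / 4 by rewrite divr_gt0.
have [F' SF' FF'] := aF _ e4; have [G' SG' GG'] := aG _ e4.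
exists (fun t => F' t + G' t); first exact: S_add.
have sF' := S_sqint SF'; have sG' := S_sqint SG'.
apply: (@le_lt_trans _ _ (2 * mean P (fun t => (F t - F' t) ^+ 2) +
                          2 * mean P (fun t => (G t - G' t) ^+ 2))).
  have i1 := (sqintB sF sF').2; have i2 := (sqintB sG sG').2.
  rewrite -!meanZ// -meanD; [|exact: intbleZ..].
  apply: le_mean.
  - exact: (sqintB (sqintD sF sG) (sqintD sF' sG')).2.
  - by apply: intbleD; exact: intbleZ.
  - move=> t; have : 0 <= (F t - F' t - (G t - G' t)) ^+ 2 by exact: sqr_ge0.
    by nra.
by lra.
Qed.

Lemma mean_sqr_mul_le F G M : sqint P F -> measurable_fun setT G ->
  (forall t, `|G t| <= M) ->
  sqint P (fun t => G t * F t) /\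
  mean P (fun t => (G t * F t) ^+ 2) <= M ^+ 2 * mean P (fun t => F t ^+ 2).
Proof.
move=> sF mG GM.
have le t : (G t * F t) ^+ 2 <= M ^+ 2 * F t ^+ 2.
  rewrite exprMn ler_wpM2r ?sqr_ge0// -(real_normK (num_real (G t))).
  by rewrite lerXn2r// nnegrE// (le_trans _ (GM t)).
have i2 : intble P (fun t => (G t * F t) ^+ 2).
  apply: intble_le (intbleZ (M ^+ 2) sF.2) _.
    by apply: measurable_funX; apply: measurable_funM => //; exact: sF.1.
  by move=> t; rewrite ger0_norm ?sqr_ge0.
split; first by split => //; apply: measurable_funM => //; exact: sF.1.
by rewrite -meanZ; [apply: le_mean => //; apply: intbleZ|]; exact: sF.2.
Qed.

Lemma L2cl_mulS F G : L2cl F -> S G -> L2cl (fun t => G t * F t).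
Proof.
move=> [sF aF] SG; have [mG [M GM]] := S_bounded SG.
split; first exact: (mean_sqr_mul_le sF mG GM).1.
(* Dividing by M^2 + 1 instead of M^2 covers the case M = 0. *)
move=> e e0; have M0 : 0 < M ^+ 2 + 1 by have := sqr_ge0 M; lra.
have [F' SF' FF'] := aF _ (divr_gt0 e0 M0).
exists (fun t => G t * F' t); first exact: S_mul.
under eq_mean do rewrite -mulrBr.
have sB := sqintB sF (S_sqint SF').
apply: le_lt_trans (mean_sqr_mul_le sB mG GM).2 _.
move: FF'; rewrite ltr_pdivlMr// mulrC; apply: le_lt_trans.
by rewrite ler_wpM2r ?lerDl// mean_ge0// => t; exact: sqr_ge0.
Qed.

(** Only F is replaced by an element F' of [S]: multiplication by the bounded G is continuous in L2,
    and G F' already lies in the closure by [L2cl_mulS]. *)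
Lemma L2cl_mul F G M : L2cl F -> L2cl G -> (forall t, `|G t| <= M) ->
  L2cl (fun t => G t * F t).
Proof.
move=> cF cG GM; have [sF aF] := cF; have [sG _] := cG.
apply: L2cl_approx; first exact: (mean_sqr_mul_le sF sG.1 GM).1.
move=> e e0; have M0 : 0 < M ^+ 2 + 1 by have := sqr_ge0 M; lra.
have [F' SF' FF'] := aF _ (divr_gt0 e0 M0).
exists (fun t => G t * F' t).
  by under eq_fun do rewrite mulrC; exact: L2cl_mulS.
under eq_mean do rewrite -mulrBr.
have sB := sqintB sF (S_sqint SF').
apply: le_lt_trans (mean_sqr_mul_le sB sG.1 GM).2 _.
move: FF'; rewrite ltr_pdivlMr// mulrC; apply: le_lt_trans.
by rewrite ler_wpM2r ?lerDl// mean_ge0// => t; exact: sqr_ge0.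
Qed.

Lemma L2cl_cst k : L2cl (fun=> k).
Proof.
by apply: sub_L2cl; have := S_scale k S_one; under eq_fun do rewrite mulr1.
Qed.

Lemma L2clZ k F : L2cl F -> L2cl (fun t => k * F t).
Proof. by move=> cF; apply: (@L2cl_mul _ _ `|k|) => //; exact: L2cl_cst. Qed.

Lemma L2clB F G : L2cl F -> L2cl G -> L2cl (fun t => F t - G t).
Proof.
move=> cF /(L2clZ (-1)) /(L2clD cF).
by congr L2cl; apply/funext => t; ring.
Qed.

Lemma L2cl_sum (I : choiceType) (s : seq I) (F : I -> T -> R) :
  (forall i, i \in s -> L2cl (F i)) -> L2cl (fun t => \sum_(i <- s) F i t).
Proof.
elim: s => [|i s IH] sF.
  by under eq_fun do rewrite big_nil; exact: L2cl_cst.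
under eq_fun do rewrite big_cons.
apply: L2clD; first by apply: sF; rewrite mem_head.
by apply: IH => j js; apply: sF; rewrite inE js orbT.
Qed.

Lemma L2clX F n : L2cl F -> (forall t, `|F t| <= 1) -> L2cl (fun t => F t ^+ n).
Proof.
move=> cF F1; elim: n => [|n IH].
  by under eq_fun do rewrite expr0; exact: L2cl_cst.
by under eq_fun do rewrite exprS; exact: L2cl_mul F1.
Qed.

(** Dominated convergence: the squared errors tend to 0 pointwise and are at most 4 G^2. *)
Lemma L2cl_lim (F_ : nat -> T -> R) F G :
  (forall n, L2cl (F_ n)) -> sqint P G ->
  (forall n t, `|F_ n t| <= `|G t|) -> (forall t, F_ n t @[n --> \oo] --> F t) ->
  L2cl F.
Proof.
move=> cF sG FG cvF.
have mF : measurable_fun setT F.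
  apply: (@measurable_fun_cvg _ _ _ _ F_) => [n|t _]; last exact: cvF.
  exact: (cF n).1.1.
have FG' t : `|F t| <= `|G t| by exact: norm_cvgn_le (cvF t) (FG ^~ t).
have sF : sqint P F by exact: sqint_le sG FG'.
apply: L2cl_approx => // e e0.
have : mean P (fun t => (F t - F_ n t) ^+ 2) @[n --> \oo] --> mean P (fun=> 0 : R).
  apply: (@dominated_mean _ _ (fun t => 4 * G t ^+ 2)).
  - by move=> n; exact: intble_measurable (sqintB sF (cF n).1).2.
  - by apply: intbleZ; exact: sG.2.
  - move=> n t; rewrite ger0_norm ?sqr_ge0//.
    have := FG n t; have := FG' t.
    rewrite -(real_normK (num_real (G t))) !ler_norml.
    have := normr_ge0 (G t); move: `|G t| => g g0 /andP[? ?] /andP[? ?]; nra.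
  - move=> t; have cB : F t - F_ n t @[n --> \oo] --> F t - F t.
      by apply: cvgB; [exact: cvg_cst|exact: cvF].
    have : (F t - F_ n t) * (F t - F_ n t) @[n --> \oo] --> (F t - F t) * (F t - F t).
      exact: (cvgM cB cB).
    by rewrite subrr mulr0; under eq_fun do rewrite -expr2.
rewrite mean_cst => /cvgr0_norm_lt /(_ _ e0)[N _ H]; exists (F_ N) => //.
by apply: le_lt_trans (H N (leqnn N)); exact: ler_norm.
Unshelve. all: end_near. Qed.

Lemma L2cl_bounded_lim (F_ : nat -> T -> R) F M :
  (forall n, L2cl (F_ n)) -> (forall n t, `|F_ n t| <= M) ->
  (forall t, F_ n t @[n --> \oo] --> F t) -> L2cl F.
Proof.
move=> cF FM cv; apply: (@L2cl_lim _ _ (fun=> M)) cv => //; first exact: sqint_cst.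
by move=> n t; rewrite (le_trans (FM n t))// ler_norm.
Qed.

(** The affine map q = (1 - u) / 2 sends u > 0 to q < 1/2. Then [step_poly n q] is a polynomial in u
    with values in [0, 1], and it converges pointwise to the indicator. *)
Lemma L2cl_gt0 (u : T -> R) : L2cl u -> (forall t, `|u t| <= 1) ->
  L2cl (\1_[set t | 0 < u t]).
Proof.
move=> cu u1; pose q t := (1 - u t) / 2.
have q01 t : 0 <= q t <= 1.
  by have := u1 t; rewrite /q ler_norml => /andP[]; lra.
have cq : L2cl q.
  have := L2clZ 2^-1 (L2clB (L2cl_cst 1) cu).
  by congr L2cl; apply/funext => t; rewrite /q mulrC.
apply: (@L2cl_bounded_lim (fun n t => step_poly n (q t)) _ 1).
- move=> n; apply: L2clX.
    apply: L2clB; first exact: L2cl_cst.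
    apply: L2clX => // t; rewrite ger0_norm; by case/andP: (q01 t).
  move=> t; have /andP[q0 q1] := q01 t; rewrite ger0_norm ?subr_ge0 ?exprn_ile1//.
  by rewrite lerBlDr lerDl exprn_ge0.
- by move=> n t; rewrite ger0_norm; case/andP: (step_poly_itv n (q01 t)).
- move=> t; have := cvg_step_poly (q01 t).
  rewrite indicE/= (_ : (q t < 2^-1) = (t \in [set t | 0 < u t]))//.
  by apply/idP/idP; rewrite inE /q /=; lra.
Qed.

Definition L2cl_set (A : set T) := L2cl (\1_A).

Lemma norm_indic_le1 (A : set T) t : `|\1_A t : R| <= 1.
Proof. by rewrite indicE; case: (_ \in _); rewrite ?normr1 ?normr0. Qed.

Lemma L2cl_set_limit (A_ : nat -> set T) (A : set T) :
  (forall n, L2cl_set (A_ n)) ->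
  (forall t, \forall n \near \oo, A_ n t <-> A t) -> L2cl_set A.
Proof.
move=> cA lim; apply: (@L2cl_bounded_lim (fun n => \1_(A_ n)) _ 1) => //.
  by move=> n t; exact: norm_indic_le1.
move=> t; apply: cvg_near_cst; apply: filterS (lim t) => n At.
rewrite !indicE (_ : (t \in A_ n) = (t \in A))//.
by apply/idP/idP; rewrite !inE => /At.
Qed.

Lemma L2cl_setC (A : set T) : L2cl_set A -> L2cl_set (~` A).
Proof.
move=> cA; have := L2clB (L2cl_cst 1) cA; congr L2cl; apply/funext => t.
by rewrite !indicE in_setC; case: (_ \in _); rewrite ?subrr ?subr0.
Qed.

Lemma L2cl_setU (A B : set T) : L2cl_set A -> L2cl_set B -> L2cl_set (A `|` B).
Proof.
move=> cA cB.
(* Inclusion-exclusion: the indicator of the union is 1_A + 1_B - 1_A 1_B. *)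
have := L2clB (L2clD cA cB) (L2cl_mul cB cA (norm_indic_le1 A)).
congr L2cl; apply/funext => t; rewrite !indicE in_setU.
by case: (_ \in A); case: (_ \in B) => /=; ring.
Qed.

Lemma L2cl_bigcup (A : nat -> set T) : (forall n, L2cl_set (A n)) ->
  L2cl_set (\bigcup_n A n).
Proof.
move=> cA; apply: (@L2cl_set_limit (fun n => \big[setU/set0]_(k < n) A k)).
  elim=> [|n IH]; last by rewrite big_ord_recr/=; exact: L2cl_setU.
  by rewrite big_ord0 /L2cl_set indic0; exact: L2cl_cst.
move=> t; have [[k _ Akt]|nA] := pselect ((\bigcup_n A n) t).
  exists k.+1 => // n /= kn; split => _; first by exists k.
  by rewrite -bigcup_mkord; exists k.
apply: nearW => n; split => // /=; rewrite -bigcup_mkord => -[k _ Akt].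
by exists k.
Qed.

Lemma sigma_algebra_L2cl : sigma_algebra setT L2cl_set.
Proof.
split.
- by rewrite /L2cl_set indic0; exact: L2cl_cst.
- by move=> A cA; rewrite setTD; exact: L2cl_setC.
- exact: L2cl_bigcup.
Qed.

(** A nonnegative f is an increasing limit of simple functions, whose compositions with X are finite
    combinations of indicators of preimages and are dominated by f o X. The general case splits f
    into positive and negative parts. *)
Lemma L2cl_comp d' (T' : measurableType d') (X : T -> T') (f : T' -> R) :
  (forall B, measurable B -> L2cl_set (X @^-1` B)) ->
  measurable_fun setT f -> sqint P (f \o X) -> L2cl (f \o X).
Proof.
move=> cX.
have nneg (h : T' -> R) : measurable_fun setT h -> (forall x, 0 <= h x) ->
    sqint P (h \o X) -> L2cl (h \o X).
  move=> mh h0 sh.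
  have [g [nd_g cv_g]] := approximation measurableT
    (proj2 (measurable_EFinP _ _) mh) (fun t _ => h0 t).
  have cvg_g x : g n x @[n --> \oo] --> h x.
    by have /fine_cvgP[_] := cv_g x Logic.I.
  apply: (@L2cl_lim (fun n => g n \o X) _ (h \o X)) => //.
  - move=> n.
    have -> : g n \o X = (fun t => \sum_(y <- finmap.enum_fset (fset_set (range (g n))))
        y * \1_(X @^-1` (g n @^-1` [set y])) t).
      by apply/funext => t /=; rewrite fimfunE fsbig_finite//=.
    apply: L2cl_sum => y _; apply: L2clZ; apply: cX.
    exact: measurable_sfunP.
  - move=> n t /=; rewrite !ger0_norm//.
    rewrite -(cvg_lim (@Rhausdorff R) (cvg_g (X t))).
    apply: nondecreasing_cvgn_le; last by apply/cvg_ex; exists (h (X t)).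
    by move=> a b ab; exact/lefP/nd_g.
  - by move=> t; exact: cvg_g.
move=> mf sf.
have -> : f \o X = (fun t => (f^\+ \o X) t - (f^\- \o X) t).
  by apply/funext => t /=; rewrite -[in LHS](funrposBneg f).
have mfX : measurable_fun setT (f \o X) := sf.1.
apply: L2clB; apply: nneg.
- exact: measurable_funrpos.
- by move=> x; exact: funrpos_ge0.
- apply: sqint_le sf _; first exact: (measurable_funrpos mfX).
  by move=> t /=; rewrite /funrpos maxEle; case: ifP => _; rewrite ?normr0.
- exact: measurable_funrneg.
- by move=> x; exact: funrneg_ge0.
- apply: sqint_le sf _; first exact: (measurable_funrneg mfX).
  by move=> t /=; rewrite /funrneg maxEle; case: ifP => _; rewrite ?normr0 ?normrN.
Qed.

End L2_closure.

(** * Density of trigonometric polynomials *)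

Section trigonometric_polynomials.
Context {R : realType} {d : measure_display} {T : measurableType d}.
Variable P : probability T R.
Implicit Types (F G L : T -> R).

Definition trig_term (a b : R) L t : R := a * cos (L t) + b * sin (L t).

(** An arbitrary finite index type lets a sum of two polynomials be indexed by the disjoint
    union. *)
Definition trigpoly (V : set (T -> R)) F :=
  exists (I : finType) (a b : I -> R) (L : I -> T -> R),
    (forall i, V (L i)) /\ F = (fun t => \sum_i trig_term (a i) (b i) (L i) t).

Lemma measurable_trig_term a b L : measurable_fun setT L ->
  measurable_fun setT (trig_term a b L).
Proof.
move=> mL; apply: measurable_funD; apply: measurable_funM => //.
- apply: (measurableT_comp _ mL); apply: continuous_measurable_fun.
  exact: continuous_cos.
- apply: (measurableT_comp _ mL); apply: continuous_measurable_fun.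
  exact: continuous_sin.
Qed.

Lemma norm_trig_term_le a b L t : `|trig_term a b L t| <= `|a| + `|b|.
Proof.
rewrite /trig_term (le_trans (ler_normD _ _))// lerD// normrM ler_piMr//.
- by rewrite ler_norml cos_geN1 cos_le1.
- by rewrite ler_norml sin_geN1 sin_le1.
Qed.

(** The product-to-sum formulas. They make trigonometric polynomials an algebra as soon as the
    phases are closed under sums and differences. *)
Lemma trig_termM a b a' b' L L' t :
  trig_term a b L t * trig_term a' b' L' t =
  trig_term ((a * a' - b * b') / 2) ((a * b' + b * a') / 2) (fun t => L t + L' t) t +
  trig_term ((a * a' + b * b') / 2) ((b * a' - a * b') / 2) (fun t => L t - L' t) t.
Proof.
by rewrite /trig_term cosD sinD cosB sinB; field.
Qed.

Variable V : set (T -> R).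
Hypothesis V_measurable : forall L, V L -> measurable_fun setT L.
Hypothesis V_add : forall L L', V L -> V L' -> V (fun t => L t + L' t).
Hypothesis V_scale : forall k L, V L -> V (fun t => k * L t).
Hypothesis V_zero : V (fun=> 0).

Lemma V_sub L L' : V L -> V L' -> V (fun t => L t - L' t).
Proof.
move=> VL /(V_scale (-1)) /(V_add VL).
by congr V; apply/funext => t; rewrite mulN1r.
Qed.

Lemma trigpoly_term a b L : V L -> trigpoly V (trig_term a b L).
Proof.
move=> VL; exists unit, (fun=> a), (fun=> b), (fun=> L); split => //.
by apply/funext => t; rewrite big_const card_unit /= addr0.
Qed.

Lemma trigpolyD F G : trigpoly V F -> trigpoly V G ->
  trigpoly V (fun t => F t + G t).
Proof.
move=> [I [a [b [L [VL ->]]]]] [J [a' [b' [L' [VL' ->]]]]].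
exists (I + J)%type, (fun k => match k with inl i => a i | inr j => a' j end),
  (fun k => match k with inl i => b i | inr j => b' j end),
  (fun k => match k with inl i => L i | inr j => L' j end).
split; first by case.
by apply/funext => t; rewrite big_sumType.
Qed.

Lemma trigpoly_sum (I : Type) (s : seq I) (F : I -> T -> R) :
  (forall i, trigpoly V (F i)) -> trigpoly V (fun t => \sum_(i <- s) F i t).
Proof.
move=> VF; elim: s => [|i s IH]; last first.
  by under eq_fun do rewrite big_cons; exact: trigpolyD.
have := trigpoly_term 0 0 V_zero; congr trigpoly.
by apply/funext => t; rewrite big_nil /trig_term !mul0r addr0.
Qed.

Lemma trigpolyM F G : trigpoly V F -> trigpoly V G ->
  trigpoly V (fun t => F t * G t).
Proof.
move=> [I [a [b [L [VL ->]]]]] [J [a' [b' [L' [VL' ->]]]]].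
under eq_fun do rewrite big_distrlr/=.
apply: trigpoly_sum => i; apply: trigpoly_sum => j.
under eq_fun do rewrite trig_termM.
by apply: trigpolyD; apply: trigpoly_term; [exact: V_add|exact: V_sub].
Qed.

Lemma trigpoly_cst k : trigpoly V (fun=> k).
Proof.
have := trigpoly_term k 0 V_zero; congr trigpoly.
by apply/funext => t; rewrite /trig_term cos0 mulr1 mul0r addr0.
Qed.

Lemma trigpolyZ k F : trigpoly V F -> trigpoly V (fun t => k * F t).
Proof. by move=> VF; apply: trigpolyM => //; exact: trigpoly_cst. Qed.

Lemma trigpoly_bounded F : trigpoly V F ->
  measurable_fun setT F /\ exists M : R, forall t, `|F t| <= M.
Proof.
move=> [I [a [b [L [VL ->]]]]]; split.
  apply: measurable_sum => i; apply: measurable_trig_term; exact: V_measurable.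
exists (\sum_i (`|a i| + `|b i|)) => t.
rewrite (le_trans (ler_norm_sum _ _ _))//; apply: ler_sum => i _.
exact: norm_trig_term_le.
Qed.

Let cl := L2cl P (trigpoly V).
Let cl_set (A : set T) := L2cl_set P (trigpoly V) A.

(* sin (eps * (L - a)) has the sign of L - a once eps is small enough. *)
Lemma trig_dense_gt L a : V L -> cl_set [set t | a < L t].
Proof.
move=> VL; pose u k t := sin (k.+1%:R^-1 * (L t - a)).
apply: (@L2cl_set_limit _ _ _ P _ trigpoly_bounded (fun k => [set t | 0 < u k t])).
- move=> k; apply: (L2cl_gt0 trigpoly_bounded (trigpoly_cst 1) trigpolyD trigpolyZ trigpolyM).
    apply: (sub_L2cl _ trigpoly_bounded).
    have := trigpoly_term (- sin (k.+1%:R^-1 * a)) (cos (k.+1%:R^-1 * a))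
      (V_scale k.+1%:R^-1 VL).
    by congr trigpoly; apply/funext => t; rewrite /trig_term /u mulrBr sinB; ring.
  by move=> t; rewrite ler_norml sin_geN1 sin_le1.
move=> t; pose x := L t - a.
have : k.+1%:R^-1 * x @[k --> \oo] --> 0 * x.
  by apply: cvgM; [exact: cvg_harmonic|exact: cvg_cst].
rewrite mul0r => /cvgr0_norm_lt/(_ _ (pi_gt0 R)).
apply: filterS => k; rewrite ltr_norml => /andP[l1 l2] /=; rewrite /u -/x.
rewrite -(subr_gt0 a) -/x.
have k0 : 0 < k.+1%:R^-1 :> R by rewrite invr_gt0.
split => [|x0]; last by apply: sin_gt0_pi; rewrite l2 mulr_gt0.
apply: contraPP => /negP; rewrite -leNgt => x0 s0.
have : 0 <= sin (- (k.+1%:R^-1 * x)).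
  apply: sin_ge0_pi; rewrite oppr_ge0 pmulr_rle0// x0/=.
  by rewrite lerNl ltW.
by rewrite sinN oppr_ge0 leNgt s0.
Qed.

(** The open rays generate the Borel sets. The translate by c is there because the phases used later
    are centered, so that L itself need not be one of them. *)
Lemma trig_dense_preimage L c (B : set R) : V (fun t => L t - c) -> measurable B ->
  cl_set (L @^-1` B).
Proof.
move=> VL mB.
have sa := sigma_algebra_L2cl P trigpoly_bounded (trigpoly_cst 1) trigpolyD trigpolyZ trigpolyM.
suff : (@measurable _ R) `<=` [set B | cl_set (L @^-1` B)] by apply.
rewrite [X in X `<=` _](RGenOInfty.measurableE R).
apply: smallest_sub.
  split => /=.
  - by rewrite preimage_set0; case: sa.
  - move=> A cA; rewrite setTD preimage_setC; case: sa => _ h _.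
    by move: (h _ cA); rewrite setTD.
  - by move=> A cA; rewrite preimage_bigcup; case: sa => _ _; apply.
move=> _ [a ->] /=.
have := trig_dense_gt (a - c) VL; rewrite /cl_set; congr L2cl_set.
by apply/seteqP; split => t /=; rewrite in_itv/= andbT; lra.
Qed.

Lemma trig_dense_tuple p (X : T -> p.-tuple R) (c : 'I_p -> R) (f : p.-tuple R -> R) :
  (forall i, V (fun t => tnth (X t) i - c i)) ->
  measurable_fun setT f -> sqint P (f \o X) -> cl (f \o X).
Proof.
move=> VX; apply: (L2cl_comp trigpoly_bounded (trigpoly_cst 1) trigpolyD trigpolyZ trigpolyM).
have sa := sigma_algebra_L2cl P trigpoly_bounded (trigpoly_cst 1) trigpolyD trigpolyZ trigpolyM.
move=> B mB.
suff : (@measurable _ (p.-tuple R)) `<=` [set B | cl_set (X @^-1` B)] by apply.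
apply: smallest_sub.
  split => /=.
  - by rewrite preimage_set0; case: sa.
  - move=> A cA; rewrite setTD preimage_setC; case: sa => _ h _.
    by move: (h _ cA); rewrite setTD.
  - by move=> A cA; rewrite preimage_bigcup; case: sa => _ _; apply.
(* The product sigma-algebra is generated by the union over the coordinates of the preimages of
   Borel sets, so one coordinate at a time is enough. *)
elim/big_ind : _ => [//|C D hC hD A [/hC|/hD]//|i _ A [C mC <-]].
by rewrite setTI; exact: (trig_dense_preimage (VX i) mC).
Qed.

Lemma trig_dense_real (Y : T -> R) c (g : R -> R) : V (fun t => Y t - c) ->
  measurable_fun setT g -> sqint P (g \o Y) -> cl (g \o Y).
Proof.
move=> VY; apply: (L2cl_comp trigpoly_bounded (trigpoly_cst 1) trigpolyD trigpolyZ trigpolyM).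
by move=> B mB; exact: (trig_dense_preimage VY mB).
Qed.

End trigonometric_polynomials.

(** * Moments and characteristic function of the normal distribution *)

Section normal_moments.
Context {R : realType}.
Local Notation mu := (@lebesgue_measure R).

(** The density agrees almost everywhere with the Radon-Nikodym derivative, both having the same
    integral over every measurable set. *)
Lemma integral_normal_prob (m s : R) (f : R -> \bar R) :
  (normal_prob m s).-integrable setT f ->
  (\int[normal_prob m s]_x f x = \int[mu]_x (f x * (normal_pdf m s x)%:E))%E.
Proof.
move=> intf; have mf := measurable_int _ intf.
have dom := @normal_prob_dominates R m s.
rewrite -(Radon_Nikodym_change_of_variables dom)//=.
apply: ae_eq_integral => //.
- apply: emeasurable_funM => //.
- apply: emeasurable_funM => //=; apply/measurableT_comp => //=.
  exact: measurable_normal_pdf.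
- apply: ae_eqe_mul2l => /=.
  rewrite Radon_NikodymE//=.
  case: cid => /= h [h1 h2 h3].
  apply: integral_ae_eq => //=.
  + by apply/measurableT_comp =>//; exact: measurable_normal_pdf.
  + by move=> E E01 mE; rewrite -h3.
Qed.

Context {d : measure_display} {T : measurableType d}.
Variables (P : probability T R) (W : T -> R) (m s : R).
Hypothesis mW : measurable_fun setT W.
Hypothesis s0 : s != 0.
Hypothesis lawW : forall A : set R, measurable A -> P (W @^-1` A) = normal_prob m s A.

(** Integrability against the density follows from the same change of variables applied to |f|. *)
Lemma normal_lawE (f : R -> R) : measurable_fun setT f -> intble P (f \o W) ->
  mu.-integrable setT (fun x => (f x * normal_pdf m s x)%:E) /\
  (\int[mu]_x (f x * normal_pdf m s x)%:E)%E = (mean P (f \o W))%:E.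
Proof.
have main (g : R -> R) : measurable_fun setT g -> intble P (g \o W) ->
    (\int[mu]_x (g x * normal_pdf m s x)%:E)%E = (mean P (g \o W))%:E.
  move=> mg ig.
  have mW' : measurable_fun setT (W : T -> measurableTypeR R) by exact: mW.
  pose X : {mfun T >-> measurableTypeR R} :=
    @mfun_Sub _ _ T (measurableTypeR R) W (mem_set mW').
  have mg' : measurable_fun [set: measurableTypeR R] (EFin \o g).
    by apply/measurable_EFinP; exact: mg.
  have eqm (h : R -> \bar R) :
      (\int[distribution P X]_x h x = \int[normal_prob m s]_x h x)%E.
    apply: (@eq_measure_integral _ (measurableTypeR R) R setT (normal_prob m s)
      (distribution P X)) => A mA _; exact: lawW.
  have iN : (normal_prob m s).-integrable setT (EFin \o g).
    apply/integrableP; split; first exact: mg'.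
    rewrite -eqm ge0_integral_distribution//; last exact: measurableT_comp.
    by have /integrableP[] := ig.
  rewrite -mean_intE// -(@integral_distribution _ _ _ _ _ P X (EFin \o g))//.
  by rewrite eqm integral_normal_prob//; apply: eq_integral => x _; rewrite EFinM.
move=> mf intf; split; last exact: main.
apply/integrableP; split.
  by apply/measurable_EFinP/measurable_funM => //; exact: measurable_normal_pdf.
have mfn : measurable_fun setT (fun x => `|f x|) by exact: measurableT_comp.
have infn : intble P ((fun x => `|f x|) \o W).
  by have := integrable_norm intf; congr integrable.
under eq_integral do rewrite /= normrM (ger0_norm (normal_pdf_ge0 _ _ _)).
by rewrite (main _ mfn infn) ltry.
Qed.

Lemma is_derive_normal_pdf (x : R) :
  is_derive x (1 : R) (normal_pdf m s) (- (x - m) / s ^+ 2 * normal_pdf m s x).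
Proof.
have -> : normal_pdf m s = (fun y => normal_peak s * normal_fun m s y).
  by rewrite normal_pdfE.
have D1 : is_derive x (1 : R) (fun y : R => - (y - m) ^+ 2 / (s ^+ 2 *+ 2))
    (- (x - m) / s ^+ 2).
  have -> : (fun y : R => - (y - m) ^+ 2 / (s ^+ 2 *+ 2)) =
     (- (s ^+ 2 *+ 2)^-1) \*: ((id - cst m) ^+ 2).
    by apply/funext => y; rewrite /= !fctE mulNr mulrC -mulNr.
  apply: is_derive_eq; rewrite /= !fctE subr0.
  by rewrite /GRing.scale/= expr1 mulr1; field.
have D2 := is_derive1_comp (is_derive_expR _) D1.
rewrite (_ : (fun y : R => _) = normal_peak s \*: (expR \o
    (fun y : R => - (y - m) ^+ 2 / (s ^+ 2 *+ 2))))//.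
by apply: is_derive_eq; rewrite /GRing.scale/= /normal_fun; ring.
Qed.

(** From exp(y) >= 1 + y >= y at y = u^2 / (2 s^2). This crude quadratic decay is enough against
    functions of linear growth. *)
Lemma normal_pdf_tail (u : R) : u != 0 ->
  normal_pdf m s (m + u) <= normal_peak s * (s ^+ 2 *+ 2 / u ^+ 2).
Proof.
move=> u0; rewrite normal_pdfE//; apply: ler_wpM2l; first exact: normal_peak_ge0.
have s2 : 0 < s ^+ 2 *+ 2 by rewrite pmulrn_lgt0// exprn_even_gt0.
have u2 : 0 < u ^+ 2 by rewrite exprn_even_gt0.
rewrite /normal_fun addrAC subrr add0r mulNr expRN -[leRHS]invf_div lef_pV2.
- by rewrite (le_trans _ (expR_ge1Dx _))// lerDr.
- by rewrite posrE expR_gt0.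
- by rewrite posrE divr_gt0.
Qed.

(** The fundamental theorem of calculus on [m - (n + 1), m + (n + 1)] leaves boundary terms of order
    1/n; dominated convergence extends the integral to the whole line. *)
Lemma integral_deriv_eq0 (F k : R -> R) (C : R) :
  (forall x : R, is_derive x (1 : R) F (k x)) -> continuous k ->
  mu.-integrable setT (EFin \o k) ->
  (forall n, `|F (m + n.+1%:R)| <= C * n.+1%:R^-1) ->
  (forall n, `|F (m - n.+1%:R)| <= C * n.+1%:R^-1) ->
  (\int[mu]_x (k x)%:E = 0)%E.
Proof.
move=> dF ck ik Fp Fm.
pose D (n : nat) : set R := [set` `[m - n.+1%:R, m + n.+1%:R]].
have mD n : measurable (D n) by exact: measurable_itv.
have I_n n : (\int[mu]_(x in D n) (k x)%:E = (F (m + n.+1%:R) - F (m - n.+1%:R))%:E)%E.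
  have n0 : 0 < n.+1%:R :> R by [].
  rewrite (@continuous_FTC2 _ k F) ?EFinB//.
  - by lra.
  - exact: continuous_subspaceT.
  - have cF x : {for x, continuous F}.
      by apply/differentiable_continuous/derivable1_diffP; case: (dF x).
    split.
    + by move=> x _; case: (dF x).
    + exact: cvg_at_right_filter (cF _).
    + exact: cvg_at_left_filter (cF _).
  - by move=> x _; rewrite derive1E derive_val.
have lim0 : (\int[mu]_(x in D n) (k x)%:E)%E @[n --> \oo] --> 0%:E.
  under eq_fun do rewrite I_n.
  apply/fine_cvgP; split; first exact: nearW.
  apply: (@squeeze_cvgr _ _ _ _ (fun n => - (2 * C) * n.+1%:R^-1)
                                (fun n => (2 * C) * n.+1%:R^-1)).
  - near=> n => /=; have := Fp n; have := Fm n; rewrite !ler_norml.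
    rewrite mulNr -mulrA; move: (C / _) (F _) (F _) => c x y.
    by move=> /andP[? ?] /andP[? ?]; apply/andP; split; lra.
  - rewrite -[X in _ --> X](mulr0 (- (2 * C))).
    by apply: cvgM; [exact: cvg_cst|exact: cvg_harmonic].
  - rewrite -[X in _ --> X](mulr0 (2 * C)).
    by apply: cvgM; [exact: cvg_cst|exact: cvg_harmonic].
have lim1 : (\int[mu]_(x in D n) (k x)%:E)%E @[n --> \oo] --> (\int[mu]_x (k x)%:E)%E.
  under eq_fun do rewrite integral_mkcond.
  apply: (@dominated_cvg _ _ _ mu setT measurableT _ _ (fun x => `|(k x)%:E|%E)).
  - move=> n; apply/(measurable_restrictT _ (mD n)).
    by apply: measurable_funTS; exact: measurable_int ik.
  - move=> x _; apply: cvg_near_cst; near=> n.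
    rewrite patchE ifT// inE /D /= in_itv/=.
    suff : `|x - m| <= n.+1%:R by rewrite ler_norml; lra.
    near: n; have [N _ NP] := nbhs_infty_ger `|x - m|.
    exists N => // n /NP /le_trans; apply; by rewrite ler_nat.
  - by [].
  - exact: integrable_abse.
  - by move=> n x _; rewrite patchE; case: ifP => // _; rewrite abse0 abse_ge0.
exact: cvg_unique lim1 lim0.
Unshelve. all: end_near. Qed.

(** Integration by parts: the difference of the two sides is the integral of the derivative of s^2
    h(x - m) times the density. *)
Lemma stein_identity (h h' : R -> R) :
  (forall u : R, is_derive u (1 : R) h (h' u)) -> continuous h' ->
  (forall u, `|h u| <= 1 + `|u|) ->
  intble P (fun t => h' (W t - m)) ->
  intble P (fun t => (W t - m) * h (W t - m)) ->
  mean P (fun t => (W t - m) * h (W t - m)) =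
  s ^+ 2 * mean P (fun t => h' (W t - m)).
Proof.
move=> dh ch' hb ih' ih.
have ch : continuous h.
  by move=> x; apply/differentiable_continuous/derivable1_diffP; case: (dh x).
have cB : continuous (fun x : R => x - m).
  by move=> x; apply: cvgB; [exact: cvg_id|exact: cvg_cst].
have chB : continuous (fun x => h (x - m)).
  by move=> x; apply: (@continuous_comp _ _ _ (fun x : R => x - m) h); [exact: cB|exact: ch].
have ch'B : continuous (fun x => h' (x - m)).
  by move=> x; apply: (@continuous_comp _ _ _ (fun x : R => x - m) h'); [exact: cB|exact: ch'].
pose f x := s ^+ 2 * h' (x - m) - (x - m) * h (x - m).
have cf : continuous f.
  move=> x; apply: cvgB; apply: cvgM; [exact: cvg_cst|exact: ch'B|exact: cB|exact: chB].
have i1 := intbleZ (s ^+ 2) ih'.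
have [ik fE] := normal_lawE (continuous_measurable_fun cf) (intbleB i1 ih).
apply/eqP; rewrite eq_sym -subr_eq0 -meanZ// -meanB//; apply/eqP.
suff : (\int[mu]_x (f x * normal_pdf m s x)%:E = 0)%E by rewrite fE => -[].
have dF (x : R) : is_derive x (1 : R)
    (fun x => s ^+ 2 * (h (x - m) * normal_pdf m s x)) (f x * normal_pdf m s x).
  have dB : is_derive x (1 : R) (fun x : R => x - m) 1.
    have -> : (fun x : R => x - m) = id - cst m by apply/funext.
    by apply: is_derive_eq; rewrite subr0.
  have d1 := @is_derive1_comp _ h (fun x : R => x - m) x _ _ (dh (x - m)) dB.
  have d2 := is_derive_normal_pdf x.
  have -> : (fun x => s ^+ 2 * (h (x - m) * normal_pdf m s x)) =
     s ^+ 2 \*: ((h \o (fun x : R => x - m)) * normal_pdf m s) by apply/funext.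
  by apply: is_derive_eq; rewrite /f /GRing.scale/= mulr1; field.
(* For |u| >= 1 the growth condition gives |h u| <= 2 |u|; multiplied by s^2 and the tail bound on
   the density, this yields the constant 4 [normal_peak s] s^4. *)
have tail (u : R) : 1 <= `|u| ->
   `|s ^+ 2 * (h (m + u - m) * normal_pdf m s (m + u))| <=
   (4 * normal_peak s * s ^+ 4) * `|u|^-1.
  move=> u1; have u0 : 0 < `|u| by lra.
  have un0 : u != 0 by rewrite -normr_gt0.
  rewrite addrAC subrr add0r normrM (normrM (h u)).
  rewrite (ger0_norm (normal_pdf_ge0 _ _ _)) (ger0_norm (sqr_ge0 _)).
  apply: (@le_trans _ _ (s ^+ 2 * ((2 * `|u|) * (normal_peak s * (s ^+ 2 *+ 2 / u ^+ 2))))).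
    apply: ler_wpM2l; first exact: sqr_ge0.
    apply: ler_pM => //; first exact: normal_pdf_ge0.
      by have := hb u; lra.
    exact: normal_pdf_tail.
  rewrite -(real_normK (num_real u)) le_eqVlt; apply/orP; left; apply/eqP.
  by field; rewrite gt_eqF.
apply: (@integral_deriv_eq0 (fun x => s ^+ 2 * (h (x - m) * normal_pdf m s x)) _
  (4 * normal_peak s * s ^+ 4)) => //.
- move=> x; apply: cvgM; [exact: cf|exact: continuous_normal_pdf].
- move=> n; have := tail n.+1%:R; rewrite normr_nat; apply; by rewrite ler1n.
- move=> n; have := tail (- n.+1%:R); rewrite normrN normr_nat; apply; by rewrite ler1n.
Qed.

Hypothesis sW : sqint P W.
Let U t := W t - m.

Let sU : sqint P U.
Proof. by apply: sqintB => //; exact: sqint_cst. Qed.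

Let continuous_scale (a : R) : continuous (fun x : R => a * x).
Proof. by move=> x; apply: cvgM; [exact: cvg_cst|exact: cvg_id]. Qed.

Let is_derive_scale (a x : R) : is_derive x (1 : R) (fun x : R => a * x) a.
Proof.
have -> : (fun x : R => a * x) = a \*: id by apply/funext.
by apply: is_derive_eq; rewrite /GRing.scale/= mulr1.
Qed.

Let measurable_comp_scale (f : R -> R) (a : R) : continuous f ->
  measurable_fun setT (fun t => f (a * U t)).
Proof.
move=> cf; apply: (measurableT_comp (continuous_measurable_fun cf)).
by apply: measurable_funM => //; exact: sU.1.
Qed.

(** Differentiation under the expectation: the derivative in x of f(x U) is U f'(x U), dominated by
    the integrable |U|. *)
Let is_derive_mean (f f' : R -> R) (a : R) :
  (forall x : R, is_derive x (1 : R) f (f' x)) -> continuous f' ->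
  (forall x, `|f x| <= 1) -> (forall x, `|f' x| <= 1) ->
  is_derive a (1 : R) (fun x => mean P (fun t => f (x * U t)))
    (mean P (fun t => U t * f' (a * U t))).
Proof.
move=> df cf' f1 f'1.
have cf : continuous f.
  by move=> x; apply/differentiable_continuous/derivable1_diffP; case: (df x).
have dg (x : R) t : is_derive x (1 : R) (fun x => f (x * U t)) (U t * f' (x * U t)).
  have d1 := is_derive_scale (U t) x.
  have d2 := @is_derive1_comp _ f (fun x => U t * x) x _ _ (df _) d1.
  have -> : (fun x => f (x * U t)) = f \o (fun x => U t * x).
    by apply/funext => y /=; rewrite mulrC.
  by apply: is_derive_eq; rewrite mulrC (mulrC x).
pose g (x : R) (t : T) : R := f (x * U t).
have Ia : [set` `]a - 1, a + 1[] a by rewrite /= in_itv/=; lra.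
have intf (x : R) : [set` `]a - 1, a + 1[] x -> P.-integrable setT (EFin \o g x).
  move=> _; apply: (@intble_bounded _ _ _ P (g x) 1); last by move=> t; exact: f1.
  exact: measurable_comp_scale cf.
have der (x : R) (t : T) : [set` `]a - 1, a + 1[] x -> setT t ->
    derivable (g ^~ t) x 1.
  by move=> _ _; case: (dg x t).
have iG : P.-integrable setT (EFin \o (fun t => `|U t|)).
  exact: integrable_norm (sqint_intble sU).
have dgE (x : R) t : partial1of2 g x t = U t * f' (x * U t).
  by rewrite /partial1of2 derive1E; case: (dg x t).
have ub (x : R) (t : T) : [set` `]a - 1, a + 1[] x -> setT t ->
    `|partial1of2 g x t| <= `|U t|.
  by move=> _ _; rewrite dgE normrM ler_piMr.
have H1 := derivable_under_integral measurableT Ia intf der (fun t => normr_ge0 (U t)) iG ub.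
have H2 := differentiation_under_integral measurableT Ia intf der (fun t => normr_ge0 (U t)) iG ub.
split; first exact: H1.
by rewrite -derive1E H2; apply: eq_mean => t; exact: dgE.
Qed.

(** Stein's identity for u -> f(a u), whose derivative is a f'(a u). *)
Let stein_scale (f f' : R -> R) (a : R) :
  (forall x : R, is_derive x (1 : R) f (f' x)) -> continuous f' ->
  (forall x, `|f x| <= 1) -> (forall x, `|f' x| <= 1) ->
  mean P (fun t => U t * f (a * U t)) = s ^+ 2 * (a * mean P (fun t => f' (a * U t))).
Proof.
move=> df cf' f1 f'1.
have cf : continuous f.
  by move=> x; apply/differentiable_continuous/derivable1_diffP; case: (df x).
have i' : intble P (fun t => f' (a * U t)).
  by apply: (@intble_bounded _ _ _ P _ 1) => //; exact: measurable_comp_scale.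
rewrite -(meanZ a i').
apply: (@stein_identity (fun u => f (a * u)) (fun u => a * f' (a * u))).
- move=> u; have d1 := is_derive_scale a u.
  have d2 := @is_derive1_comp _ f (fun x => a * x) u _ _ (df _) d1.
  by apply: is_derive_eq; rewrite mulrC.
- move=> x; apply: cvgM; first exact: cvg_cst.
  apply: (@continuous_comp _ _ _ (fun x => a * x) f'); first exact: continuous_scale.
  exact: cf'.
- by move=> u; rewrite (le_trans (f1 _))// lerDl.
- exact: intbleZ.
- apply: sqint_mul => //.
  by apply: (@sqint_bounded _ _ _ P _ 1) => //; exact: measurable_comp_scale.
Qed.

(** Integrating factor: C(a) exp(s^2 a^2 / 2) has zero derivative, hence is constant. *)
Let ode_gauss (C : R -> R) :
  (forall a : R, is_derive a (1 : R) C (- (s ^+ 2 * (a * C a)))) ->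
  forall a, C a = C 0 * expR (- (s ^+ 2 * a ^+ 2 / 2)).
Proof.
move=> dC a; pose e (a : R) := expR (s ^+ 2 * a ^+ 2 / 2).
have de (x : R) : is_derive x (1 : R) e (s ^+ 2 * x * e x).
  have d1 : is_derive x (1 : R) (fun a : R => s ^+ 2 * a ^+ 2 / 2) (s ^+ 2 * x).
    have -> : (fun a : R => s ^+ 2 * a ^+ 2 / 2) = (s ^+ 2 / 2) \*: (id ^+ 2).
      by apply/funext => y; rewrite /= !fctE /GRing.scale/=; ring.
    by apply: is_derive_eq; rewrite /GRing.scale/= expr1 mulr1; field.
  have d2 := is_derive1_comp (is_derive_expR _) d1.
  by apply: is_derive_eq; rewrite mulrC.
have d0 (x : R) : is_derive x (1 : R) (C * e) 0.
  have dCx := dC x; have dex := de x.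
  by apply: is_derive_eq; rewrite /GRing.scale/=; ring.
have := is_derive_0_is_cst a 0 d0; rewrite !fctE /e expr0n/= mulr0 mul0r expR0 mulr1.
by move=> <-; rewrite expRN mulfK// gt_eqF// expR_gt0.
Qed.

(** For C(a) = E[cos(a U)], C'(a) = -E[U sin(a U)] = -s^2 a C(a) by Stein's identity, and C(0) =
    1. *)
Lemma normal_cos_mean a :
  mean P (fun t => cos (a * U t)) = expR (- (s ^+ 2 * a ^+ 2 / 2)).
Proof.
have c1 (x : R) : `|cos x| <= 1 by rewrite ler_norml cos_geN1 cos_le1.
have s1 (x : R) : `|sin x| <= 1 by rewrite ler_norml sin_geN1 sin_le1.
have csN : continuous (fun x : R => - sin x).
  by move=> x; apply: cvgN; exact: continuous_sin.
have := @ode_gauss (fun a => mean P (fun t => cos (a * U t))).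
rewrite [mean P (fun t => cos (0 * U t))](@eq_mean _ _ _ P _ (fun=> 1)); last first.
  by move=> t; rewrite mul0r cos0.
move=> H; apply: etrans (H _ a) _; last by rewrite mean_cst mul1r.
move=> b; apply: is_derive_eq.
  apply: (@is_derive_mean cos (fun x => - sin x)) => // x; last by rewrite normrN.
rewrite -(stein_scale b (@is_derive_sin R) (@continuous_cos R) s1 c1).
rewrite -[RHS]mulN1r -meanZ.
  by apply: eq_mean => t; ring.
apply: sqint_mul => //.
apply: (@sqint_bounded _ _ _ P _ 1) => //; apply: measurable_comp_scale.
exact: continuous_sin.
Qed.

(** The same differential equation as for the cosine, now with initial value 0. *)
Lemma normal_sin_mean a : mean P (fun t => sin (a * U t)) = 0.
Proof.
have c1 (x : R) : `|cos x| <= 1 by rewrite ler_norml cos_geN1 cos_le1.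
have s1 (x : R) : `|sin x| <= 1 by rewrite ler_norml sin_geN1 sin_le1.
have csN : continuous (fun x : R => - sin x).
  by move=> x; apply: cvgN; exact: continuous_sin.
have := @ode_gauss (fun a => mean P (fun t => sin (a * U t))).
rewrite [mean P (fun t => sin (0 * U t))](@eq_mean _ _ _ P _ (fun=> 0)); last first.
  by move=> t; rewrite mul0r sin0.
move=> H; apply: etrans (H _ a) _; last by rewrite mean_cst mul0r.
move=> b; apply: is_derive_eq.
  exact: (@is_derive_mean sin cos b (@is_derive_sin R) (@continuous_cos R)).
rewrite (@stein_scale cos (fun x => - sin x) b)//; last by move=> x; rewrite normrN.
rewrite [mean P (fun t => - sin _)](@eq_mean _ _ _ P _ (fun t => -1 * sin (b * U t))).
  rewrite meanZ; first by ring.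
  apply: (@intble_bounded _ _ _ P _ 1) => //; apply: measurable_comp_scale.
  exact: continuous_sin.
by move=> t; rewrite mulN1r.
Qed.

(** Stein's identity with h = 1. *)
Lemma normal_mean : mean P W = m.
Proof.
have : mean P (fun t => U t * 1) = s ^+ 2 * mean P (fun=> 0).
  apply: (@stein_identity (fun=> 1) (fun=> 0)).
  - by move=> x; exact: cvg_cst.
  - by move=> u; rewrite normr1 lerDl.
  - exact: intble_cst.
  - by under eq_fun do rewrite mulr1; exact: sqint_intble sU.
rewrite mean_cst mulr0.
under eq_mean do rewrite mulr1.
rewrite meanB ?mean_cst; [|exact: sqint_intble|exact: intble_cst].
by move=> /eqP; rewrite subr_eq0 => /eqP.
Qed.

(** Stein's identity with h the identity function. *)
Lemma normal_variance : mean P (fun t => U t ^+ 2) = s ^+ 2.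
Proof.
rewrite -[RHS]mulr1 -(mean_cst P 1).
apply: (@stein_identity id (fun=> 1)).
- by move=> x; exact: cvg_cst.
- by move=> u; rewrite lerDr.
- exact: intble_cst.
- exact: sqint_mul.
Qed.

End normal_moments.

(** * Covariance of Gaussian trigonometric polynomials *)

Section gram_kernels.
Context {R : realType} {d : measure_display} {T : measurableType d}.
Variable P : probability T R.

Definition psd (I : finType) (K : I -> I -> R) :=
  forall x : I -> R, 0 <= \sum_i \sum_j x i * x j * K i j.

Variables (I : finType) (L : I -> T -> R).
Hypothesis sL : forall i, sqint P (L i).
Let kappa i j := mean P (fun t => L i t * L j t).

(* The Schur product theorem for a Gram kernel: the Hadamard product is an
   average of congruent copies of K. *)
Lemma psd_gram_mul (K : I -> I -> R) : psd K -> psd (fun i j => K i j * kappa i j).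
Proof.
move=> psdK x.
have ij i j : intble P (fun t => (x i * x j * K i j) * (L i t * L j t)).
  by apply: intbleZ; exact: sqint_mul.
have -> : \sum_i \sum_j x i * x j * (K i j * kappa i j) =
    mean P (fun t => \sum_i \sum_j (x i * x j * K i j) * (L i t * L j t)).
  rewrite (intble_mean_sum _ _).2; last by move=> i; exact: (intble_mean_sum _ _).1.
  apply: eq_bigr => i _; rewrite (intble_mean_sum _ _).2//.
  by apply: eq_bigr => j _; rewrite meanZ ?mulrA//; exact: sqint_mul.
apply: mean_ge0 => t; rewrite (_ : \sum_i _ =
    \sum_i \sum_j (x i * L i t) * (x j * L j t) * K i j); first exact: psdK.
by apply: eq_bigr => i _; apply: eq_bigr => j _; ring.
Qed.

Lemma sum_mul_sqr (J : finType) (x : J -> R) :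
  \sum_i \sum_j x i * x j = (\sum_i x i) ^+ 2.
Proof. by rewrite expr2 big_distrlr. Qed.

(** Here [tau i] stands for E[L_i Y] with Y of unit variance. The hypothesis [tau_le] bounds the
    correlation of Y with every combination of the L_i: rho^2 kappa - tau tau^T is positive
    semidefinite. *)
Variables (tau : I -> R) (rho : R).
Hypothesis tau_le : forall x : I -> R,
  (\sum_i x i * tau i) ^+ 2 <= rho ^+ 2 * \sum_i \sum_j x i * x j * kappa i j.

Lemma psd_rank1_exp n :
  psd (fun i j => rho ^+ (2 * n) * kappa i j ^+ n - tau i ^+ n * tau j ^+ n).
Proof.
elim: n => [|n IH] x.
  by rewrite big1// => i _; rewrite big1// => j _; rewrite muln0 !expr0 !mulr1 subrr mulr0.
(* Writing K_n for the kernel at n, K_{n+1} is rho^2 times the Hadamard product of K_n and kappa,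
   plus that of tau^n (tau^n)^T and rho^2 kappa - tau tau^T. The first part comes from the test
   vector rho x, the second from [tau_le] at x_i tau_i^n. *)
have := psd_gram_mul IH; move=> /(_ (fun i => rho * x i)) H1.
have := tau_le (fun i => x i * tau i ^+ n); rewrite -subr_ge0 => H2.
have := addr_ge0 H1 H2; congr (_ <= _).
rewrite mulr_sumr -sum_mul_sqr -sumrB -big_split/=; apply: eq_bigr => i _.
rewrite mulr_sumr -sumrB -big_split/=; apply: eq_bigr => j _.
rewrite mulnS exprD !exprS expr0; ring.
Qed.

Lemma rank1_exp_le n (x : I -> R) : (\sum_i x i * tau i ^+ n) ^+ 2 <=
  rho ^+ (2 * n) * \sum_i \sum_j x i * x j * kappa i j ^+ n.
Proof.
rewrite -subr_ge0; have := psd_rank1_exp n x; congr (_ <= _).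
rewrite mulr_sumr -sum_mul_sqr -sumrB; apply: eq_bigr => i _.
by rewrite mulr_sumr -sumrB; apply: eq_bigr => j _; ring.
Qed.

Lemma psd_gram_exp n : psd (fun i j => kappa i j ^+ n).
Proof.
elim: n => [x|n IH].
  under eq_bigr do under eq_bigr do rewrite mulr1.
  by rewrite sum_mul_sqr sqr_ge0.
by move=> x; under eq_bigr do under eq_bigr do rewrite exprSr; exact: psd_gram_mul.
Qed.

Hypothesis rho01 : 0 <= rho <= 1.

(** The kernels involving sigma have rank one, so the claim reduces to 2 x y <= rho (A + y^2), where
    x^2 <= rho^2 A because rho^(2 (n + 1)) <= rho^2. It follows from (x - rho y)^2 >= 0. *)
Lemma cross_exp_le (J : finType) (alpha : I -> R) (beta sigma : J -> R) n :
  2 * \sum_i \sum_j alpha i * beta j * (tau i * sigma j) ^+ n.+1 <=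
  rho * (\sum_i \sum_j alpha i * alpha j * kappa i j ^+ n.+1 +
         \sum_i \sum_j beta i * beta j * (sigma i * sigma j) ^+ n.+1).
Proof.
set A := (X in rho * (X + _)).
have -> : \sum_i \sum_j beta i * beta j * (sigma i * sigma j) ^+ n.+1 =
    (\sum_i beta i * sigma i ^+ n.+1) ^+ 2.
  rewrite -sum_mul_sqr; apply: eq_bigr => i _; apply: eq_bigr => j _.
  by rewrite exprMn mulrACA.
have -> : \sum_i \sum_j alpha i * beta j * (tau i * sigma j) ^+ n.+1 =
    (\sum_i alpha i * tau i ^+ n.+1) * (\sum_i beta i * sigma i ^+ n.+1).
  rewrite big_distrlr/=; apply: eq_bigr => i _; apply: eq_bigr => j _.
  by rewrite exprMn mulrACA.
have A0 : 0 <= A by exact: psd_gram_exp.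
have /andP[r0 r1] := rho01.
have : (\sum_i alpha i * tau i ^+ n.+1) ^+ 2 <= rho ^+ 2 * A.
  apply: le_trans (rank1_exp_le _ _) _; apply: ler_wpM2r => //.
  by apply: ler_wiXn2l => //; rewrite leq_pmulr.
move: (\sum_i alpha i * _) (\sum_i beta i * _) => x y xA.
(* When rho = 0, the bound on x^2 forces x = 0. *)
have [r00|rn0] := eqVneq rho 0.
  by move: xA; rewrite r00 expr0n mul0r => xA; nra.
have rp : 0 < rho by rewrite lt_neqAle eq_sym rn0.
rewrite -(ler_pM2l rp); have : 0 <= (x - rho * y) ^+ 2 by exact: sqr_ge0.
by nra.
Qed.

End gram_kernels.

(** * Power series of the covariance kernels and summation of the termwise inequalities *)

Section exponential_kernel.
Context {R : realType}.
Implicit Types a b c : R.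

(** The expression a a' (cosh c - 1) + b b' sinh c, which will be the covariance of two
    trigonometric terms with rescaled coefficients. *)
Definition cosh_sinh a a' b b' c : R :=
  a * a' * ((expR c + expR (- c)) / 2 - 1) + b * b' * ((expR c - expR (- c)) / 2).

(* Coefficients of c ^ n / n`! in the Taylor series of cosh_sinh, in rank-one
   form: even powers carry a, odd powers carry b, and the constant vanishes. *)
Definition parity_coef a b n : R := if odd n then b else if n == 0%N then 0 else a.

Lemma cvg_cosh_sinh a a' b b' c :
  \sum_(n < N) n`!%:R^-1 * (parity_coef a b n * parity_coef a' b' n * c ^+ n)
    @[N --> \oo] --> cosh_sinh a a' b b' c.
Proof.
have ce x : series (exp_coeff x) N @[N --> \oo] --> expR x.
  exact: is_cvg_series_exp_coeff.
have lim : a * a' * ((series (exp_coeff c) N + series (exp_coeff (- c)) N) / 2 - 1) +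
    b * b' * ((series (exp_coeff c) N - series (exp_coeff (- c)) N) / 2)
    @[N --> \oo] --> cosh_sinh a a' b b' c.
  apply: cvgD; apply: cvgM; try exact: cvg_cst.
    apply: cvgB; last exact: cvg_cst.
    by apply: cvgM; [apply: cvgD; exact: ce|exact: cvg_cst].
  by apply: cvgM; [apply: cvgB; exact: ce|exact: cvg_cst].
apply: cvg_trans lim; apply: near_eq_cvg.
(* The partial sums agree exactly, but only from N = 1 on: the constant term of the exponential
   series has to be present to cancel the -1. *)
exists 1%N => // -[//|N] _ /=.
elim: N => [|N IH].
  rewrite big_ord_recr big_ord0/= /parity_coef/= /series/= !big_nat1 /exp_coeff/=.
  by rewrite fact0 !expr0; field.
have sS (u : nat -> R) n : series u n.+1 = series u n + u n.
  by rewrite !seriesEord/= big_ord_recr.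
rewrite big_ord_recr/= -IH !(sS _ N.+1) /exp_coeff/= exprNn -signr_odd.
rewrite /parity_coef; move: (series _ _) (series _ _) (c ^+ N.+1) => x y z.
have f0 : (N.+1)`!%:R != 0 :> R by rewrite pnatr_eq0 -lt0n fact_gt0.
move: (N.+1`!%:R) f0 => f f0.
by case: (odd N.+1) => /=; rewrite ?expr1 ?expr0; field.
Qed.

Lemma cvg_sum_fin (I : finType) (u : I -> nat -> R) (l : I -> R) :
  (forall i, u i N @[N --> \oo] --> l i) -> \sum_i u i N @[N --> \oo] --> \sum_i l i.
Proof. by move=> ul; apply: cvg_big => //; exact: add_continuous. Qed.

Context {d : measure_display} {T : measurableType d}.
Variables (P : probability T R) (I J : finType) (L : I -> T -> R).
Hypothesis sL : forall i, sqint P (L i).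
Let kappa i j := mean P (fun t => L i t * L j t).
Variables (tau : I -> R) (rho : R).
Hypothesis tau_le : forall x : I -> R,
  (\sum_i x i * tau i) ^+ 2 <= rho ^+ 2 * \sum_i \sum_j x i * x j * kappa i j.
Hypothesis rho01 : 0 <= rho <= 1.

(** The inequality holds for each power of the kernels, with the parity coefficients in place of a
    and b; it is summed with the nonnegative weights 1 / n! and passed to the limit. The power 0
    contributes nothing. *)
Lemma cross_cosh_sinh_le (a b : I -> R) (a' b' sigma : J -> R) :
  2 * \sum_i \sum_j cosh_sinh (a i) (a' j) (b i) (b' j) (tau i * sigma j) <=
  rho * (\sum_i \sum_j cosh_sinh (a i) (a j) (b i) (b j) (kappa i j) +
         \sum_i \sum_j cosh_sinh (a' i) (a' j) (b' i) (b' j) (sigma i * sigma j)).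
Proof.
have lim (A B : finType) (x y : A -> R) (x' y' : B -> R) (K : A -> B -> R) :
    \sum_i \sum_j \sum_(n < N) n`!%:R^-1 *
      (parity_coef (x i) (y i) n * parity_coef (x' j) (y' j) n * K i j ^+ n)
    @[N --> \oo] --> \sum_i \sum_j cosh_sinh (x i) (x' j) (y i) (y' j) (K i j).
  by apply: cvg_sum_fin => i; apply: cvg_sum_fin => j; exact: cvg_cosh_sinh.
have swap (A B : finType) (x y : A -> R) (x' y' : B -> R) (K : A -> B -> R) N :
    \sum_i \sum_j \sum_(n < N) n`!%:R^-1 *
      (parity_coef (x i) (y i) n * parity_coef (x' j) (y' j) n * K i j ^+ n) =
    \sum_(n < N) n`!%:R^-1 * \sum_i \sum_j
      (parity_coef (x i) (y i) n * parity_coef (x' j) (y' j) n * K i j ^+ n).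
  under eq_bigr do rewrite exchange_big/=.
  rewrite exchange_big/=; apply: eq_bigr => n _; rewrite mulr_sumr.
  by apply: eq_bigr => i _; rewrite mulr_sumr.
pose part (A B : finType) (x y : A -> R) (x' y' : B -> R) (K : A -> B -> R) N : R :=
  \sum_i \sum_j \sum_(n < N) n`!%:R^-1 *
    (parity_coef (x i) (y i) n * parity_coef (x' j) (y' j) n * K i j ^+ n).
have key N : 2 * part I J a b a' b' (fun i j => tau i * sigma j) N <=
    rho * (part I I a b a b kappa N +
           part J J a' b' a' b' (fun i j => sigma i * sigma j) N).
  rewrite /part !swap -big_split/= !mulr_sumr; apply: ler_sum => n _.
  rewrite -mulrDr !(mulrCA _ (_^-1)); apply: ler_wpM2l; first by rewrite invr_ge0.
  case: n => -[|n] nN /=; last exact: cross_exp_le.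
  by do 3 (rewrite big1; last by move=> i _; rewrite big1// => j _; rewrite !mul0r);
    rewrite addr0 !mulr0.
have l1 := cvgM (cvg_cst (2 : R)) (lim I J a b a' b' (fun i j => tau i * sigma j)).
have l2 := cvgM (cvg_cst rho) (cvgD (lim I I a b a b kappa)
  (lim J J a' b' a' b' (fun i j => sigma i * sigma j))).
by apply: (ler_cvg_to (l1 _ _) (l2 _ _ _)); near=> N; exact: key.
Unshelve. all: end_near. Qed.

End exponential_kernel.

(** * Covariances of trigonometric polynomials whose phases have Gaussian characteristic
    functions *)

Section gaussian_trig.
Context {R : realType} {d : measure_display} {T : measurableType d}.
Variable P : probability T R.
Variable V : set (T -> R).
Hypothesis V_sqint : forall L, V L -> sqint P L.
Hypothesis V_add : forall L L', V L -> V L' -> V (fun t => L t + L' t).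
Hypothesis V_scale : forall k L, V L -> V (fun t => k * L t).
Hypothesis V_cos : forall L, V L ->
  mean P (fun t => cos (L t)) = expR (- (mean P (fun t => L t ^+ 2) / 2)).
Hypothesis V_sin : forall L, V L -> mean P (fun t => sin (L t)) = 0.

Let e L := expR (- (mean P (fun t => L t ^+ 2) / 2)).

Definition cov (F G : T -> R) := mean P (fun t => F t * G t) - mean P F * mean P G.

Lemma trig_term_sqint a b L : V L -> sqint P (trig_term a b L).
Proof.
move=> VL; apply: (@sqint_bounded _ _ _ P _ (`|a| + `|b|)).
  by apply: measurable_trig_term; exact: (V_sqint VL).1.
by move=> t; exact: norm_trig_term_le.
Qed.

Lemma mean_trig_term a b L : V L -> mean P (trig_term a b L) = a * e L.
Proof.
move=> VL.
have ic : intble P (fun t => cos (L t)).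
  apply: sqint_intble; have := trig_term_sqint 1 0 VL; congr sqint.
  by apply/funext => t; rewrite /trig_term mul1r mul0r addr0.
have iss : intble P (fun t => sin (L t)).
  apply: sqint_intble; have := trig_term_sqint 0 1 VL; congr sqint.
  by apply/funext => t; rewrite /trig_term mul1r mul0r add0r.
rewrite meanD; [|exact: intbleZ..].
by rewrite !meanZ// V_cos// V_sin// mulr0 addr0.
Qed.

(** By the product-to-sum formulas only the phases L + L' and L - L' occur, with E[cos (L + L')] =
    e(L) e(L') exp(-c) and E[cos (L - L')] = e(L) e(L') exp(c). The product of the means gives the
    -1 next to cosh c. *)
Lemma cov_trig_term a b a' b' L L' : V L -> V L' ->
  cov (trig_term a b L) (trig_term a' b' L') =
  cosh_sinh (a * e L) (a' * e L') (b * e L) (b' * e L') (mean P (fun t => L t * L' t)).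
Proof.
move=> VL VL'; have VD := V_add VL VL'.
have VB : V (fun t => L t - L' t).
  have := V_add VL (V_scale (-1) VL'); congr V.
  by apply/funext => t; rewrite mulN1r.
have sL := V_sqint VL; have sL' := V_sqint VL'.
set c := mean P (fun t => L t * L' t).
have eD : e (fun t => L t + L' t) = e L * e L' * expR (- c).
  rewrite /e -!expRD; congr expR.
  rewrite (@eq_mean _ _ _ P _ (fun t => L t ^+ 2 + L' t ^+ 2 + 2 * (L t * L' t))); last first.
    by move=> t; ring.
  rewrite !meanD ?meanZ -/c; first by field.
  1-5: by do ?[exact: sL.2|exact: sL'.2|exact: sqint_mul|apply: intbleZ|apply: intbleD].
have eB : e (fun t => L t - L' t) = e L * e L' * expR c.
  rewrite /e -!expRD; congr expR.
  rewrite (@eq_mean _ _ _ P _ (fun t => L t ^+ 2 + L' t ^+ 2 + (-2) * (L t * L' t))); last first.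
    by move=> t; ring.
  rewrite !meanD ?meanZ -/c; first by field.
  1-5: by do ?[exact: sL.2|exact: sL'.2|exact: sqint_mul|apply: intbleZ|apply: intbleD].
rewrite /cov; under eq_mean do rewrite trig_termM.
rewrite meanD; [|by apply: sqint_intble; apply: trig_term_sqint..].
by rewrite !mean_trig_term// eD eB /cosh_sinh; ring.
Qed.

Lemma cov_sum (I J : finType) (F : I -> T -> R) (G : J -> T -> R) :
  (forall i, sqint P (F i)) -> (forall j, sqint P (G j)) ->
  cov (fun t => \sum_i F i t) (fun t => \sum_j G j t) = \sum_i \sum_j cov (F i) (G j).
Proof.
move=> sF sG; rewrite /cov.
rewrite (intble_mean_sum _ (fun i => sqint_intble (sF i))).2.
rewrite (intble_mean_sum _ (fun i => sqint_intble (sG i))).2.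
under eq_mean do rewrite big_distrlr/=.
have ij i j : intble P (fun t => F i t * G j t) by exact: sqint_mul.
rewrite (intble_mean_sum _ _).2; last by move=> i; exact: (intble_mean_sum _ _).1.
rewrite big_distrlr/= -sumrB; apply: eq_bigr => i _.
by rewrite (intble_mean_sum _ _).2// -sumrB.
Qed.

Variables (VX VY : set (T -> R)) (Y : T -> R) (rho : R).
Hypothesis VXV : VX `<=` V.
Hypothesis VX_add : forall L L', VX L -> VX L' -> VX (fun t => L t + L' t).
Hypothesis VX_scale : forall k L, VX L -> VX (fun t => k * L t).
Hypothesis VX_zero : VX (fun=> 0).
Hypothesis V_Y : V Y.
Hypothesis Y_unit : mean P (fun t => Y t ^+ 2) = 1.
Hypothesis VYE : forall L, VY L -> exists k : R, L = (fun t => k * Y t).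
Hypothesis rho01 : 0 <= rho <= 1.
Hypothesis rho_corr : forall L, VX L ->
  mean P (fun t => L t * Y t) ^+ 2 <= rho ^+ 2 * mean P (fun t => L t ^+ 2).

Lemma trig_cov_le F G : trigpoly VX F -> trigpoly VY G ->
  2 * cov F G <= rho * (cov F F + cov G G).
Proof.
move=> [I [a [b [L [VL ->]]]]] [J [a' [b' [M [VM ->]]]]].
(* Every phase on the Y side is a multiple sigma_j of Y, so its Gram kernel is sigma_i sigma_j and
   the cross kernel is tau_i sigma_j. *)
have /choice[sigma Msigma] j := VYE (VM j).
have VM' j : V (M j) by rewrite Msigma; exact: V_scale.
have VL' i : V (L i) by exact: VXV.
have sY := V_sqint V_Y.
rewrite !cov_sum; do ?[by move=> ?; exact: trig_term_sqint].
under eq_bigr do under eq_bigr do rewrite cov_trig_term//.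
under [X in rho * (X + _)]eq_bigr do under eq_bigr do rewrite cov_trig_term//.
under [X in rho * (_ + X)]eq_bigr do under eq_bigr do rewrite cov_trig_term//.
have cMM i j : mean P (fun t => M i t * M j t) = sigma i * sigma j.
  rewrite !Msigma (@eq_mean _ _ _ P _ (fun t => sigma i * sigma j * Y t ^+ 2)).
    by rewrite meanZ ?Y_unit ?mulr1//; exact: sY.2.
  by move=> t; ring.
have cLM i j : mean P (fun t => L i t * M j t) =
    mean P (fun t => L i t * Y t) * sigma j.
  rewrite mulrC -meanZ; last by apply: sqint_mul => //; exact: V_sqint.
  by apply: eq_mean => t; rewrite Msigma; ring.
under eq_bigr do under eq_bigr do rewrite cLM.
under [X in rho * (_ + X)]eq_bigr do under eq_bigr do rewrite cMM.
apply: cross_cosh_sinh_le => // [i|x]; first exact: V_sqint.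
(* The hypothesis [rho_corr] at this combination, once expanded, is the condition on [tau]. *)
have VXs : VX (fun t => \sum_i x i * L i t).
  elim: (index_enum I) => [|i s IH].
    by under eq_fun do rewrite big_nil.
  by under eq_fun do rewrite big_cons; apply: VX_add => //; exact: VX_scale.
have := rho_corr VXs; congr (_ <= _).
  congr (_ ^+ 2); under eq_mean do rewrite mulr_suml.
  have iLY i : intble P (fun t => L i t * Y t) by apply: sqint_mul => //; exact: V_sqint.
  have iLY' i : intble P (fun t => x i * L i t * Y t).
    by have := intbleZ (x i) (iLY i); under eq_fun do rewrite mulrA.
  rewrite (intble_mean_sum _ iLY').2; apply: eq_bigr => i _.
  by under eq_mean do rewrite -mulrA; rewrite meanZ.
congr (_ * _).
under eq_mean do rewrite expr2 big_distrlr/=.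
have iLL i j : intble P (fun t => L i t * L j t) by apply: sqint_mul; exact: V_sqint.
have iLL' i j : intble P (fun t => x i * L i t * (x j * L j t)).
  by have := intbleZ (x i * x j) (iLL i j); congr intble; apply/funext => t; ring.
rewrite (intble_mean_sum _ _).2; last by move=> i; exact: (intble_mean_sum _ _).1.
apply: eq_bigr => i _; rewrite (intble_mean_sum _ _).2//.
apply: eq_bigr => j _; rewrite -meanZ//.
by apply: eq_mean => t; ring.
Qed.

End gaussian_trig.

(** * Maximal correlation *)

Section cov_continuity.
Context {R : realType} {d : measure_display} {T : measurableType d}.
Variable P : probability T R.
Implicit Types F G : T -> R.

Lemma norm_mean_mul_le F G : sqint P F -> sqint P G ->
  `|mean P (fun t => F t * G t)| <=
  Num.sqrt (mean P (fun t => F t ^+ 2)) * Num.sqrt (mean P (fun t => G t ^+ 2)).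
Proof.
move=> sF sG; rewrite -sqrtrM; last by apply: mean_ge0 => t; exact: sqr_ge0.
rewrite -sqrtr_sqr ler_sqrt; first exact: mean_CauchySchwarz.
by apply: mulr_ge0; apply: mean_ge0 => t; exact: sqr_ge0.
Qed.

Lemma cvg_mean_mul (F_ G_ : nat -> T -> R) F G :
  (forall n, sqint P (F_ n)) -> (forall n, sqint P (G_ n)) ->
  sqint P F -> sqint P G ->
  mean P (fun t => (F t - F_ n t) ^+ 2) @[n --> \oo] --> (0 : R) ->
  mean P (fun t => (G t - G_ n t) ^+ 2) @[n --> \oo] --> (0 : R) ->
  mean P (fun t => F_ n t * G_ n t) @[n --> \oo] --> mean P (fun t => F t * G t).
Proof.
move=> sF_ sG_ sF sG cF cG.
pose dF n : R := Num.sqrt (mean P (fun t => (F t - F_ n t) ^+ 2)).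
pose dG n : R := Num.sqrt (mean P (fun t => (G t - G_ n t) ^+ 2)).
have dF0 : dF n @[n --> \oo] --> (0 : R).
  rewrite -(sqrtr0 R); apply: (cvg_comp _ _ cF); exact: sqrt_continuous.
have dG0 : dG n @[n --> \oo] --> (0 : R).
  rewrite -(sqrtr0 R); apply: (cvg_comp _ _ cG); exact: sqrt_continuous.
pose nF : R := Num.sqrt (mean P (fun t => F t ^+ 2)).
pose nG : R := Num.sqrt (mean P (fun t => G t ^+ 2)).
have bd n : `|mean P (fun t => F t * G t) - mean P (fun t => F_ n t * G_ n t)| <=
    dF n * nG + nF * dG n + dF n * dG n.
  have sdF := sqintB sF (sF_ n); have sdG := sqintB sG (sG_ n).
  (* This decomposition involves only the limits and the errors, so no uniform bound on the norms of
     F_n and G_n is required. *)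
  have -> : mean P (fun t => F t * G t) - mean P (fun t => F_ n t * G_ n t) =
      mean P (fun t => (F t - F_ n t) * G t) + mean P (fun t => F t * (G t - G_ n t))
      - mean P (fun t => (F t - F_ n t) * (G t - G_ n t)).
    rewrite -meanD; [|exact: sqint_mul..].
    have iD : intble P (fun t => (F t - F_ n t) * G t + F t * (G t - G_ n t)).
      by apply: intbleD; exact: sqint_mul.
    rewrite -(meanB iD (sqint_mul sdF sdG)) -(meanB (sqint_mul sF sG) (sqint_mul (sF_ n) (sG_ n))).
    by apply: eq_mean => t; ring.
  rewrite (le_trans (ler_normB _ _))// lerD//; last exact: norm_mean_mul_le.
  by rewrite (le_trans (ler_normD _ _))// lerD//; exact: norm_mean_mul_le.
apply/cvgrPdist_le => e e0.
have : dF n * nG + nF * dG n + dF n * dG n @[n --> \oo] --> 0 * nG + nF * 0 + 0 * 0.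
  apply: cvgD; last exact: (cvgM dF0 dG0).
  by apply: cvgD; apply: cvgM => //; exact: cvg_cst.
rewrite !mul0r mulr0 !addr0 => /cvgr0_norm_le /(_ _ e0).
by apply: filterS => n /(le_trans (ler_norm _)); exact: le_trans (bd n).
Qed.

Lemma cvg_cov (F_ G_ : nat -> T -> R) F G :
  (forall n, sqint P (F_ n)) -> (forall n, sqint P (G_ n)) ->
  sqint P F -> sqint P G ->
  mean P (fun t => (F t - F_ n t) ^+ 2) @[n --> \oo] --> (0 : R) ->
  mean P (fun t => (G t - G_ n t) ^+ 2) @[n --> \oo] --> (0 : R) ->
  cov P (F_ n) (G_ n) @[n --> \oo] --> cov P F G.
Proof.
move=> sF_ sG_ sF sG cF cG; have s1 := sqint_cst P 1.
have c1 : mean P (fun=> (1 - 1 : R) ^+ 2) @[n --> \oo] --> (0 : R).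
  by rewrite subrr expr0n mean_cst; exact: cvg_cst.
(* Convergence of means is convergence of mean products with second factor 1. *)
have mF : mean P (F_ n) @[n --> \oo] --> mean P F.
  have := @cvg_mean_mul F_ (fun _ _ => 1) F (fun=> 1) sF_ (fun=> s1) sF s1 cF c1.
  under eq_fun do under eq_mean do rewrite mulr1.
  by under [in X in _ --> X -> _]eq_mean do rewrite mulr1.
have mG : mean P (G_ n) @[n --> \oo] --> mean P G.
  have := @cvg_mean_mul G_ (fun _ _ => 1) G (fun=> 1) sG_ (fun=> s1) sG s1 cG c1.
  under eq_fun do under eq_mean do rewrite mulr1.
  by under [in X in _ --> X -> _]eq_mean do rewrite mulr1.
by apply: cvgB; [exact: cvg_mean_mul|exact: cvgM].
Qed.

Lemma L2cl_seq (S : set (T -> R)) F : L2cl P S F ->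
  exists F_ : nat -> T -> R, (forall n, S (F_ n)) /\
    mean P (fun t => (F t - F_ n t) ^+ 2) @[n --> \oo] --> (0 : R).
Proof.
move=> [_ aF].
have /choice[F_ HF] (n : nat) : exists G, S G /\
    mean P (fun t => (F t - G t) ^+ 2) < n.+1%:R^-1.
  by have [|G SG FG] := aF n.+1%:R^-1; [rewrite invr_gt0|exists G].
exists F_; split => [n|]; first exact: (HF n).1.
apply: (@squeeze_cvgr _ _ _ _ (cst 0) (fun n => n.+1%:R^-1)).
- near=> n; rewrite mean_ge0/= 1?ltW//; last by move=> t; exact: sqr_ge0.
  exact: (HF n).2.
- exact: cvg_cst.
- exact: cvg_harmonic.
Unshelve. all: end_near. Qed.

End cov_continuity.

(** * Characteristic function of a possibly degenerate Gaussian variable *)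

Section gaussian_rv_charfun.
Context {R : realType} {d : measure_display} {T : measurableType d}.
Variables (P : probability T R) (W : T -> R).
Hypothesis sW : sqint P W.

(** The preimage of the complement of {m} has probability 0, so W = m almost surely. *)
Lemma dirac_law_mean (m : R) (f : R -> R) :
  (forall A : set R, measurable A -> P (W @^-1` A) = \d_m A) ->
  measurable_fun setT f -> mean P (fun t => f (W t)) = f m.
Proof.
move=> lawW mf; rewrite -[RHS](mean_cst P).
rewrite /mean /Rintegral; congr fine; apply: ae_eq_integral => //.
  by apply/measurable_EFinP/measurableT_comp => //; exact: sW.1.
exists (W @^-1` (~` [set m])); split.
- rewrite -[X in measurable X]setTI; apply: sW.1 => //.
  exact: measurableC.
- have := lawW (~` [set m]) (measurableC (measurable_set1 m)).
  by rewrite diracE memNset//; apply.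
- by move=> t /= H Wm; apply: H => _; rewrite /= Wm.
Qed.

Lemma gaussian_rv_charfun : gaussian_rv P W ->
  mean P (fun t => cos (W t - mean P W)) =
    expR (- (mean P (fun t => (W t - mean P W) ^+ 2) / 2)) /\
  mean P (fun t => sin (W t - mean P W)) = 0.
Proof.
move=> [m [s law]]; have [s0|s0] := eqVneq s 0.
  have {}law A : measurable A -> P (W @^-1` A) = \d_m A.
    by move=> /law; rewrite s0 eqxx.
  have mW : mean P W = m by rewrite (@dirac_law_mean m id).
  have mB : measurable_fun setT (fun x : R => x - m) by exact: measurable_funB.
  rewrite mW (@dirac_law_mean m (fun x => cos (x - m)))//; last first.
    by apply: (measurableT_comp _ mB); apply: continuous_measurable_fun; exact: continuous_cos.
  rewrite (@dirac_law_mean m (fun x => sin (x - m)))//; last first.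
    by apply: (measurableT_comp _ mB); apply: continuous_measurable_fun; exact: continuous_sin.
  rewrite (@dirac_law_mean m (fun x => (x - m) ^+ 2))//; last exact: measurable_funX.
  by rewrite subrr cos0 sin0 expr0n/= mul0r oppr0 expR0.
have {}law A : measurable A -> P (W @^-1` A) = normal_prob m s A.
  by move=> /law; rewrite (negbTE s0).
have mW := normal_mean sW.1 s0 law sW.
have vW := normal_variance sW.1 s0 law sW.
have cW := normal_cos_mean sW.1 s0 law sW 1.
have nW := normal_sin_mean sW.1 s0 law sW 1.
rewrite mW vW; split.
- under eq_mean do rewrite -[X in cos X]mul1r.
  by rewrite cW expr1n mulr1.
- by under eq_mean do rewrite -[X in sin X]mul1r.
Qed.

End gaussian_rv_charfun.

(** * Centered linear forms in a random vector with prescribed moments *)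

Section moments.
Context {R : realType} {d : measure_display} {T : measurableType d}.
Variables (P : probability T R) (n : nat) (Z : 'I_n -> T -> R).
Variables (mu : 'rV[R]_n) (Lam : 'M[R]_n).
Hypothesis mZ : forall i, measurable_fun setT (Z i).
Hypothesis momZ : has_moments P Z mu Lam.

Definition clin (u : 'I_n -> R) t := \sum_i u i * (Z i t - mu ord0 i).
(** The covariance of two linear forms, written through [mu] and [Lam] alone, so that it is the same
    number for every competing law. *)
Definition qcov (u v : 'I_n -> R) :=
  \sum_i \sum_j u i * v j * (Lam i j - mu ord0 i * mu ord0 j).

(** Since F^2 >= 0, a finite value of its integral already gives integrability. *)
Lemma finite_sqint (F : T -> R) (c : R) : measurable_fun setT F ->
  (\int[P]_t (F t ^+ 2)%:E = c%:E)%E -> sqint P F.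
Proof.
move=> mF iF; split => //; apply/integrableP; split.
  by apply/measurable_EFinP; exact: measurable_funX.
under eq_integral do rewrite /= ger0_norm ?sqr_ge0//.
by rewrite iF ltry.
Qed.

Lemma moments_sqint i : sqint P (Z i).
Proof.
by apply: (@finite_sqint _ (Lam i i)) => //; have := momZ.2 i i.
Qed.

Lemma clin_sqint u : sqint P (clin u).
Proof.
apply: sqint_sum => i; apply: sqintZ; apply: sqintB; last exact: sqint_cst.
exact: moments_sqint.
Qed.

Lemma moments_mean i : mean P (Z i) = mu ord0 i.
Proof. by rewrite /mean /Rintegral momZ.1. Qed.

Lemma moments_mean_mul i j : mean P (fun t => Z i t * Z j t) = Lam i j.
Proof. by rewrite /mean /Rintegral momZ.2. Qed.

Lemma mean_clin u : mean P (clin u) = 0.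
Proof.
have iZ i : intble P (fun t => Z i t - mu ord0 i).
  by apply: intbleB; [exact/sqint_intble/moments_sqint|exact: intble_cst].
rewrite (intble_mean_sum _ _).2; last by move=> i; exact: intbleZ.
rewrite big1// => i _; rewrite meanZ// meanB ?mean_cst ?moments_mean ?subrr ?mulr0//.
- exact/sqint_intble/moments_sqint.
- exact: intble_cst.
Qed.

Lemma mean_clin_mul u v : mean P (fun t => clin u t * clin v t) = qcov u v.
Proof.
under eq_mean do rewrite big_distrlr/=.
have sB i : sqint P (fun t => Z i t - mu ord0 i).
  by apply: sqintB; [exact: moments_sqint|exact: sqint_cst].
have iuv i j : intble P (fun t => u i * (Z i t - mu ord0 i) * (v j * (Z j t - mu ord0 j))).
  by apply: sqint_mul; apply: sqintZ.
rewrite (intble_mean_sum _ _).2; last by move=> i; exact: (intble_mean_sum _ _).1.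
apply: eq_bigr => i _; rewrite (intble_mean_sum _ _).2//; apply: eq_bigr => j _.
rewrite (@eq_mean _ _ _ P _ (fun t => u i * v j *
  ((Z i t - mu ord0 i) * (Z j t - mu ord0 j)))); last by move=> t; ring.
rewrite meanZ; last exact: sqint_mul.
congr (_ * _).
have si := moments_sqint i; have sj := moments_sqint j.
rewrite (@eq_mean _ _ _ P _ (fun t => Z i t * Z j t - mu ord0 j * Z i t -
  (mu ord0 i * Z j t - mu ord0 i * mu ord0 j))); last by move=> t; ring.
rewrite !meanB ?meanZ ?mean_cst ?moments_mean ?moments_mean_mul; first by ring.
all: by do ?[exact: sqint_mul|exact: sqint_intble|exact: intble_cst|apply: intbleZ|apply: intbleB].
Qed.

Lemma clinD u v : clin (fun i => u i + v i) = (fun t => clin u t + clin v t).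
Proof.
by apply/funext => t; rewrite /clin -big_split; apply: eq_bigr => i _; rewrite /= mulrDl.
Qed.

Lemma clinZ k u : clin (fun i => k * u i) = (fun t => k * clin u t).
Proof.
by apply/funext => t; rewrite /clin mulr_sumr; apply: eq_bigr => i _; rewrite mulrA.
Qed.

Lemma clin_delta j : clin (fun i => (i == j)%:R) = (fun t => Z j t - mu ord0 j).
Proof.
apply/funext => t; rewrite /clin (bigD1 j)//= eqxx mul1r big1 ?addr0// => i ij.
by rewrite (negbTE ij) mul0r.
Qed.

Lemma mean_clin_sqr u : mean P (fun t => clin u t ^+ 2) = qcov u u.
Proof. by rewrite -mean_clin_mul; apply: eq_mean => t; rewrite expr2. Qed.

Lemma qcov_CauchySchwarz u v : qcov u v ^+ 2 <= qcov u u * qcov v v.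
Proof.
have := mean_CauchySchwarz (clin_sqint u) (clin_sqint v).
by rewrite mean_clin_mul !mean_clin_sqr.
Qed.

Lemma qcov_ge0 u : 0 <= qcov u u.
Proof. by rewrite -mean_clin_sqr; apply: mean_ge0 => t; exact: sqr_ge0. Qed.

(** Joint Gaussianity concerns the uncentered combination W; [clin u] is W minus its mean. *)
Lemma clin_charfun u : jointly_gaussian P Z ->
  mean P (fun t => cos (clin u t)) = expR (- (mean P (fun t => clin u t ^+ 2) / 2)) /\
  mean P (fun t => sin (clin u t)) = 0.
Proof.
move=> /(_ u) gW; set W := (fun t => _) in gW.
have sW : sqint P W by apply: sqint_sum => i; apply: sqintZ; exact: moments_sqint.
have -> : clin u = (fun t => W t - mean P W).
  apply/funext => t.
  have -> : mean P W = \sum_i u i * mu ord0 i.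
    rewrite (intble_mean_sum _ _).2; last first.
      by move=> i; apply: intbleZ; exact/sqint_intble/moments_sqint.
    by apply: eq_bigr => i _; rewrite meanZ ?moments_mean//; exact/sqint_intble/moments_sqint.
  by rewrite /W -sumrB; apply: eq_bigr => i _; rewrite mulrBr.
exact: gaussian_rv_charfun.
Qed.

End moments.

(** * Linear lower bound for any law, upper bound for the Gaussian law *)

Section maximal_correlation.
Context {R : realType} {d : measure_display} {T : measurableType d}.
Variables (P : probability T R) (p : nat) (Z : 'I_p.+1 -> T -> R).
Variables (mu : 'rV[R]_p.+1) (Lam : 'M[R]_p.+1).
Hypothesis mZ : forall i, measurable_fun setT (Z i).
Hypothesis momZ : has_moments P Z mu Lam.

Let wid (i : 'I_p) : 'I_p.+1 := widen_ord (leqnSn p) i.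
(** Coefficient vector of the form Y, so that [qc deltaY deltaY] is the variance of Y. *)
Definition deltaY (i : 'I_p.+1) : R := (i == ord_max)%:R.

Local Notation lin := (clin Z mu).
Local Notation qc := (qcov mu Lam).

Lemma measurable_Xpart : measurable_fun setT (Xpart Z).
Proof.
apply/measurable_fun_tnthP => i.
by have := mZ (wid i); congr measurable_fun; apply/funext => t /=; rewrite tnth_mktuple.
Qed.

(** The condition on [u] makes the form depend on X alone. Dividing the centered forms by their
    standard deviations gives an admissible pair of test functions. *)
Lemma hgr_ge_linear_corr (u : 'I_p.+1 -> R) : u ord_max = 0 ->
  0 < qc u u -> 0 < qc deltaY deltaY ->
  ((qc u deltaY / Num.sqrt (qc u u * qc deltaY deltaY))%:E <=
    hgr_maxcorr P (Xpart Z) (Ypart Z))%E.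
Proof.
move=> u0 quu qYY; apply: ereal_sup_ubound.
pose su : R := (Num.sqrt (qc u u))^-1; pose sY : R := (Num.sqrt (qc deltaY deltaY))^-1.
pose f (x : p.-tuple R) : R := su * \sum_i u (wid i) * (tnth x i - mu ord0 (wid i)).
pose g (y : R) : R := sY * (y - mu ord0 ord_max).
have fE t : f (Xpart Z t) = su * lin u t.
  rewrite /f /clin big_ord_recr/= u0 mul0r addr0; congr (_ * _).
  by apply: eq_bigr => i _; rewrite tnth_mktuple.
have gE t : g (Ypart Z t) = sY * lin deltaY t by rewrite clin_delta.
have slu := clin_sqint mZ momZ u; have slY := clin_sqint mZ momZ deltaY.
have su2 : su ^+ 2 * qc u u = 1.
  by rewrite /su exprVn sqr_sqrtr ?ltW// mulVf// gt_eqF.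
have sY2 : sY ^+ 2 * qc deltaY deltaY = 1.
  by rewrite /sY exprVn sqr_sqrtr ?ltW// mulVf// gt_eqF.
have intE k w : (\int[P]_t (k * lin w t)%:E = 0)%E.
  have iw := sqint_intble (clin_sqint mZ momZ w).
  rewrite mean_intE; last exact: intbleZ.
  rewrite meanZ//.
  by rewrite (mean_clin mZ momZ) mulr0.
have intM k l v w : (\int[P]_t (k * lin v t * (l * lin w t))%:E = (k * l * qc v w)%:E)%E.
  have sv := clin_sqint mZ momZ v; have sw := clin_sqint mZ momZ w.
  rewrite mean_intE; last by apply: sqint_mul; exact: sqintZ.
  rewrite -(mean_clin_mul mZ momZ) -meanZ; last exact: sqint_mul.
  by congr EFin; apply: eq_mean => t; ring.
exists f, g; split.
- apply: measurable_funM => //; apply: measurable_sum => i.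
  apply: measurable_funM => //; apply: measurable_funB => //.
  exact: measurable_tnth.
- by apply: measurable_funM => //; exact: measurable_funB.
- by split; under eq_integral do rewrite ?fE ?gE; exact: intE.
- split; under eq_integral do rewrite ?fE ?gE expr2.
  + by rewrite intM -expr2 su2.
  + by rewrite intM -expr2 sY2.
- under eq_integral do rewrite fE gE.
  by rewrite intM sqrtrM ?ltW// invfM /su /sY mulrC.
Qed.

Hypothesis gauss : jointly_gaussian P Z.

Let V : set (T -> R) := [set L | exists u, L = lin u].
Let VX : set (T -> R) := [set L | exists2 u, u ord_max = 0 & L = lin u].
Let VY : set (T -> R) := [set L | exists k, L = lin (fun i => k * deltaY i)].

Let V_sqint L : V L -> sqint P L.
Proof. by move=> [u ->]; exact: (clin_sqint mZ momZ). Qed.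

Let V_add L L' : V L -> V L' -> V (fun t => L t + L' t).
Proof. by move=> [u ->] [v ->]; exists (fun i => u i + v i); rewrite clinD. Qed.

Let V_scale k L : V L -> V (fun t => k * L t).
Proof. by move=> [u ->]; exists (fun i => k * u i); rewrite clinZ. Qed.

Let V_cos L : V L ->
  mean P (fun t => cos (L t)) = expR (- (mean P (fun t => L t ^+ 2) / 2)).
Proof. by move=> [u ->]; exact: (clin_charfun mZ momZ u gauss).1. Qed.

Let V_sin L : V L -> mean P (fun t => sin (L t)) = 0.
Proof. by move=> [u ->]; exact: (clin_charfun mZ momZ u gauss).2. Qed.

Let VXV : VX `<=` V.
Proof. by move=> L [u _ ->]; exists u. Qed.

Let VYV : VY `<=` V.
Proof. by move=> L [k ->]; exists (fun i => k * deltaY i). Qed.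

Let VX_add L L' : VX L -> VX L' -> VX (fun t => L t + L' t).
Proof.
move=> [u u0 ->] [v v0 ->]; exists (fun i => u i + v i); last by rewrite clinD.
by rewrite u0 v0 addr0.
Qed.

Let VX_scale k L : VX L -> VX (fun t => k * L t).
Proof.
by move=> [u u0 ->]; exists (fun i => k * u i); rewrite ?clinZ// u0 mulr0.
Qed.

Let clin0 : lin (fun=> 0) = (fun=> 0).
Proof. by apply/funext => t; rewrite /clin big1// => i _; rewrite mul0r. Qed.

Let VX_zero : VX (fun=> 0).
Proof. by exists (fun=> 0); rewrite ?clin0. Qed.

Let VY_add L L' : VY L -> VY L' -> VY (fun t => L t + L' t).
Proof.
move=> [k ->] [l ->]; exists (k + l); rewrite !clinZ; apply/funext => t.
by rewrite mulrDl.
Qed.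

Let VY_scale k L : VY L -> VY (fun t => k * L t).
Proof.
by move=> [l ->]; exists (k * l); rewrite !clinZ; apply/funext => t; rewrite mulrA.
Qed.

Let VY_zero : VY (fun=> 0).
Proof. by exists 0; rewrite clinZ; apply/funext => t; rewrite mul0r. Qed.

Let X_dense f : measurable_fun setT f -> sqint P (f \o Xpart Z) ->
  L2cl P (trigpoly VX) (f \o Xpart Z).
Proof.
apply: (@trig_dense_tuple _ _ _ P VX _ VX_add VX_scale VX_zero _ _
  (fun i => mu ord0 (wid i))); first by move=> L /VXV /V_sqint[].
move=> i; exists (fun j => (j == wid i)%:R).
  by rewrite /wid (_ : _ == _ = false)//; apply/negbTE; rewrite neq_ltn /= ltn_ord orbT.
by rewrite clin_delta; apply/funext => t; rewrite tnth_mktuple.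
Qed.

Let Y_dense g : measurable_fun setT g -> sqint P (g \o Ypart Z) ->
  L2cl P (trigpoly VY) (g \o Ypart Z).
Proof.
apply: (@trig_dense_real _ _ _ P VY _ VY_add VY_scale VY_zero _
  (mu ord0 ord_max)); first by move=> L /VYV /V_sqint[].
by exists 1; rewrite clinZ clin_delta; apply/funext => t; rewrite mul1r.
Qed.

Let trigpoly_sqint V' F : V' `<=` V -> trigpoly V' F -> sqint P F.
Proof.
move=> V'V [I [a [b [L [VL ->]]]]]; apply: sqint_sum => i.
exact: (trig_term_sqint V_sqint _ _ (V'V _ (VL i))).
Qed.

(** By Cauchy-Schwarz all covariances of phases vanish, so trigonometric polynomials have variance
    0, and so do their L2 limits. *)
Lemma cov_degenerate (V' : set (T -> R)) F : V' `<=` V ->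
  (forall L, V' L -> mean P (fun t => L t ^+ 2) = 0) ->
  L2cl P (trigpoly V') F -> cov P F F = 0.
Proof.
move=> V'V deg cF; have [F_ [tF cvF]] := L2cl_seq cF.
have sF_ n : sqint P (F_ n) by exact: trigpoly_sqint (tF n).
have := cvg_cov sF_ sF_ cF.1 cF.1 cvF cvF.
have F0 n : cov P (F_ n) (F_ n) = 0.
  have [I [a [b [L [VL ->]]]]] := tF n.
  have VL' i : V (L i) by exact: V'V.
  rewrite cov_sum; [|by move=> i; exact: (trig_term_sqint V_sqint)..].
  rewrite big1// => i _; rewrite big1// => j _.
  rewrite (cov_trig_term V_sqint V_add V_scale V_cos V_sin)//.
  have -> : mean P (fun t => L i t * L j t) = 0.
    have := mean_CauchySchwarz (V_sqint (VL' i)) (V_sqint (VL' j)).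
    rewrite (deg _ (VL i)) mul0r => h; apply/eqP; rewrite -sqrf_eq0 eq_le h.
    exact: sqr_ge0.
  by rewrite /cosh_sinh oppr0 expR0; field.
under eq_fun do rewrite F0.
by move=> /(cvg_unique (@Rhausdorff R)) /(_ (cvg_cst _)).
Qed.

Lemma gaussian_cov_le (rho : R) F G : 0 <= rho <= 1 ->
  0 < qc deltaY deltaY ->
  (forall u, u ord_max = 0 ->
    qc u deltaY ^+ 2 <= rho ^+ 2 * (qc u u * qc deltaY deltaY)) ->
  L2cl P (trigpoly VX) F -> L2cl P (trigpoly VY) G ->
  2 * cov P F G <= rho * (cov P F F + cov P G G).
Proof.
move=> rho01 qY rhole cF cG.
have [F_ [tF cvF]] := L2cl_seq cF; have [G_ [tG cvG]] := L2cl_seq cG.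
have sF_ n : sqint P (F_ n) by exact: trigpoly_sqint (tF n).
have sG_ n : sqint P (G_ n) by exact: trigpoly_sqint (tG n).
(* Rescaling by the standard deviation k gives Y unit variance, as [trig_cov_le] demands. *)
pose k : R := Num.sqrt (qc deltaY deltaY).
have k0 : k != 0 by rewrite gt_eqF// sqrtr_gt0.
have k2 : k ^+ 2 = qc deltaY deltaY by rewrite sqr_sqrtr// ltW.
pose Y t := k^-1 * lin deltaY t.
have VY1 : V Y by apply: V_scale; exists deltaY.
have slY := clin_sqint mZ momZ deltaY.
have YE : mean P (fun t => Y t ^+ 2) = 1.
  rewrite (@eq_mean _ _ _ P _ (fun t => k ^- 2 * (lin deltaY t ^+ 2))).
    by rewrite meanZ ?(mean_clin_sqr mZ momZ) -?k2 ?mulVf ?expf_neq0//; exact: slY.2.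
  by move=> t; rewrite /Y exprMn exprVn.
have key n : 2 * cov P (F_ n) (G_ n) <=
    rho * (cov P (F_ n) (F_ n) + cov P (G_ n) (G_ n)).
  apply: (@trig_cov_le _ _ _ P V V_sqint V_add V_scale V_cos V_sin VX VY Y) => //.
  - move=> L [l ->]; exists (l * k); rewrite clinZ; apply/funext => t.
    by rewrite /Y mulrA mulfK.
  - move=> L [u u0 ->]; rewrite (mean_clin_sqr mZ momZ).
    rewrite (@eq_mean _ _ _ P _ (fun t => k^-1 * (lin u t * lin deltaY t))); last first.
      by move=> t; rewrite /Y; ring.
    rewrite meanZ; last by apply: sqint_mul => //; exact: (clin_sqint mZ momZ).
    rewrite (mean_clin_mul mZ momZ) exprMn exprVn k2 mulrC ler_pdivrMr//.
    by rewrite -mulrA; exact: rhole.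
have c1 := cvg_cov sF_ sG_ cF.1 cG.1 cvF cvG.
have c2 := cvg_cov sF_ sF_ cF.1 cF.1 cvF cvF.
have c3 := cvg_cov sG_ sG_ cG.1 cG.1 cvG cvG.
have l1 := cvgM (cvg_cst (2 : R)) c1.
have l2 := cvgM (cvg_cst rho) (cvgD c2 c3).
by apply: (ler_cvg_to (l1 _ _) (l2 _ _ _)); near=> n; exact: key.
Unshelve. all: end_near. Qed.

Let sqint_comp d' (T' : measurableType d') (X : T -> T') (f : T' -> R) :
  measurable_fun setT X -> measurable_fun setT f ->
  (\int[P]_t (f (X t) ^+ 2)%:E = 1)%E -> sqint P (f \o X).
Proof.
by move=> mX mf f1; apply: (@finite_sqint _ _ _ P _ 1) => //; exact: measurableT_comp.
Qed.

(** Admissible f(X) and g(Y) have variance 1 and lie in the closures of the trigonometric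
    polynomials, so [gaussian_cov_le] reads 2 E[f g] <= 2 rho. *)
Lemma gaussian_hgr_le (rho : R) : 0 <= rho <= 1 ->
  (forall u, u ord_max = 0 ->
    qc u deltaY ^+ 2 <= rho ^+ 2 * (qc u u * qc deltaY deltaY)) ->
  0 < qc deltaY deltaY ->
  (hgr_maxcorr P (Xpart Z) (Ypart Z) <= rho%:E)%E.
Proof.
move=> rho01 rhole qY; apply: ub_ereal_sup => _ [f [g [mf mg [f0 g0] [f1 g1] ->]]].
have sf := sqint_comp measurable_Xpart mf f1.
have sg := sqint_comp (mZ ord_max) mg g1.
have := gaussian_cov_le rho01 qY rhole (X_dense mf sf) (Y_dense mg sg).
rewrite mean_intE; last exact: (sqint_mul sf sg).
rewrite lee_fin /cov [mean P (f \o _)]/mean /Rintegral f0 [mean P (g \o _)]/mean /Rintegral g0.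
rewrite !mul0r !subr0.
have -> : mean P (fun t => (f \o Xpart Z) t * (f \o Xpart Z) t) = 1.
  by rewrite /mean /Rintegral; under eq_integral do rewrite -expr2; rewrite f1.
have -> : mean P (fun t => (g \o Ypart Z) t * (g \o Ypart Z) t) = 1.
  by rewrite /mean /Rintegral; under eq_integral do rewrite -expr2; rewrite g1.
by rewrite /=; lra.
Qed.

(** No admissible pair exists: f(X) or g(Y) would have variance both 0 and 1. The supremum of the
    empty set is [-oo]. *)
Lemma gaussian_hgr_degenerate :
  qc deltaY deltaY = 0 \/ (forall u, u ord_max = 0 -> qc u u = 0) ->
  hgr_maxcorr P (Xpart Z) (Ypart Z) = -oo%E.
Proof.
move=> deg; apply/eqP; rewrite -leeNy_eq; apply: ub_ereal_sup.
move=> r [f [g [mf mg [f0 g0] [f1 g1] _]]]; exfalso.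
have sf := sqint_comp measurable_Xpart mf f1.
have sg := sqint_comp (mZ ord_max) mg g1.
case: deg => [dY|dX].
- have : cov P (g \o Ypart Z) (g \o Ypart Z) = 0.
    apply: (cov_degenerate VYV _ (Y_dense mg sg)) => L [k ->].
    rewrite clinZ (@eq_mean _ _ _ P _ (fun t => k ^+ 2 * (lin deltaY t ^+ 2))).
      by rewrite meanZ ?(mean_clin_sqr mZ momZ) ?dY ?mulr0//; exact: (clin_sqint mZ momZ _).2.
    by move=> t; rewrite exprMn.
  rewrite /cov [mean P (g \o _)]/mean /Rintegral g0 mul0r subr0.
  rewrite /mean /Rintegral; under eq_integral do rewrite -expr2.
  by rewrite g1 /= => /eqP; rewrite oner_eq0.
- have : cov P (f \o Xpart Z) (f \o Xpart Z) = 0.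
    apply: (cov_degenerate VXV _ (X_dense mf sf)) => L [u u0 ->].
    by rewrite (mean_clin_sqr mZ momZ) dX.
  rewrite /cov [mean P (f \o _)]/mean /Rintegral f0 mul0r subr0.
  rewrite /mean /Rintegral; under eq_integral do rewrite -expr2.
  by rewrite f1 /= => /eqP; rewrite oner_eq0.
Qed.

End maximal_correlation.

Theorem theorem1 (R : realType) (p : nat) (hp : (1 <= p)%N)
    (mu : 'rV[R]_p.+1) (Lam : 'M[R]_p.+1)
    (dG : measure_display) (TG : measurableType dG) (PG : probability TG R)
    (ZG : 'I_p.+1 -> TG -> R)
    (hZGm : forall i, measurable_fun setT (ZG i))
    (hGauss : jointly_gaussian PG ZG)
    (hGmom : has_moments PG ZG mu Lam) :
  forall (d : measure_display) (T : measurableType d) (P : probability T R)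
    (Z : 'I_p.+1 -> T -> R),
    (forall i, measurable_fun setT (Z i)) ->
    has_moments P Z mu Lam ->
    (hgr_maxcorr PG (Xpart ZG) (Ypart ZG) <= hgr_maxcorr P (Xpart Z) (Ypart Z))%E.
Proof.
move=> d T P Z mZ momZ.
pose qc := qcov mu Lam.
(* These facts are read off the Gaussian vector, but concern only [mu] and [Lam]. *)
have qc_ge0 u : 0 <= qc u u := qcov_ge0 hZGm hGmom u.
have CS u v : qc u v ^+ 2 <= qc u u * qc v v := qcov_CauchySchwarz hZGm hGmom u v.
have [dY|dY] := eqVneq (qc (@deltaY R p) (@deltaY R p)) 0.
  by rewrite (gaussian_hgr_degenerate hZGm hGmom hGauss (or_introl dY)) leNye.
have qY : 0 < qc (@deltaY R p) (@deltaY R p) by rewrite lt_neqAle eq_sym dY qc_ge0.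
have [dX|/existsNP[u0 /not_implyP[u00 /eqP qu0]]] :=
    pselect (forall u : 'I_p.+1 -> R, u ord_max = 0 -> qc u u = 0).
  by rewrite (gaussian_hgr_degenerate hZGm hGmom hGauss (or_intror dX)) leNye.
have corr u : u ord_max = 0 -> 0 < qc u u ->
    ((`|qc u (@deltaY R p)| / Num.sqrt (qc u u * qc (@deltaY R p) (@deltaY R p)))%:E <=
     hgr_maxcorr P (Xpart Z) (Ypart Z))%E.
  move=> uM qu; have [q0|/ltW q0] := leP 0 (qc u (@deltaY R p)).
    rewrite (ger0_norm q0); exact: (hgr_ge_linear_corr mZ momZ).
  (* A negative covariance is turned positive by replacing [u] with its opposite, which gives the
     bound for the absolute value. *)
  have qN v : qc (fun i => - u i) v = - qc u v.
    rewrite /qc /qcov -sumrN; apply: eq_bigr => i _; rewrite -sumrN.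
    by apply: eq_bigr => j _; rewrite !mulNr.
  have qNN : qc (fun i => - u i) (fun i => - u i) = qc u u.
    by apply: eq_bigr => i _; apply: eq_bigr => j _; rewrite mulrNN.
  have := @hgr_ge_linear_corr _ _ _ P p Z mu Lam mZ momZ (fun i => - u i).
  rewrite -/qc qNN qN (ler0_norm q0); apply => //; by rewrite uM oppr0.
(* The value [-oo] is excluded by the nondegenerate form [u0], whose correlation is a finite lower
   bound. *)
move: corr; case: (hgr_maxcorr P _ _) => [r| |] corr; last 2 first.
- by rewrite leey.
- have := corr u0 u00; rewrite lt_neqAle eq_sym qu0 qc_ge0 => /(_ isT).
  by rewrite leeNy_eq.
have r0 : 0 <= r.
  have := corr u0 u00; rewrite lt_neqAle eq_sym qu0 qc_ge0 => /(_ isT).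
  by rewrite lee_fin; apply: le_trans; rewrite divr_ge0.
(* The Gaussian bound needs rho <= 1, hence rho = min(r, 1). If r > 1, the condition on linear forms
   is Cauchy-Schwarz; otherwise it comes from [corr]. *)
apply: (@le_trans _ _ (Num.min r 1)%:E); last by rewrite lee_fin ge_min lexx.
apply: (gaussian_hgr_le hZGm hGmom hGauss) => //.
  by rewrite le_min r0 ler01 ge_min lexx orbT.
move=> u uM; have [q0|q0] := eqVneq (qc u u) 0.
  by have := CS u (@deltaY R p); rewrite -/qc q0 !mul0r mulr0.
have qu : 0 < qc u u by rewrite lt_neqAle eq_sym q0 qc_ge0.
have [r1|r1] := leP r 1; last by rewrite expr1n mul1r; exact: CS.
have qq : 0 < qc u u * qc (@deltaY R p) (@deltaY R p) by rewrite mulr_gt0.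
have := corr u uM qu; rewrite lee_fin ler_pdivrMr ?sqrtr_gt0// => h.
rewrite -(real_normK (num_real (qcov _ _ _ _))).
rewrite -[X in _ * X](sqr_sqrtr (ltW qq)) -exprMn lerXn2r// nnegrE.
by rewrite mulr_ge0// sqrtr_ge0.
Qed.
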